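(* Let $K$ be an infinite field. Let $Q=(Q_0,Q_1)$ be a quiver with no oriented cycles, let $n=|Q_0|$, and let $\alpha\in\mathbb{Z}_{\ge 0}^{Q_0}$ be a dimension vector. Then the null cone for the action of $\mathrm{SL}_\alpha$ on $\mathrm{Rep}(Q,\alpha)$ is defined by semi-invariants for nonzero weights $\sigma$ such that $$|\sigma|_\alpha\le \frac{\|\alpha\|_1^{2n}}{4(n-1)^{2n-2}},$$ that is, the null cone $\mathcal N\subseteq \mathrm{Rep}(Q,\alpha)$ equals the common zero set of all $f\in \mathrm{SI}(Q,\alpha)_\sigma$, where $\sigma$ ranges over the nonzero weights $\sigma\in\mathbb{Z}^{Q_0}$ with $\sigma\cdot\alpha=0$ satisfying this inequality.
   Context: A quiver $Q=(Q_0,Q_1)$ is a finite directed graph with vertex set $Q_0$ and arrow set $Q_1$; an arrow $a$ has tail $ta$ and head $ha$. For a dimension vector $\alpha\in\mathbb{Z}_{\ge0}^{Q_0}$, $\mathrm{Rep}(Q,\alpha)=\prod_{a\in Q_1}\mathrm{Mat}_{\alpha(ha),\alpha(ta)}(K)$, $\mathrm{GL}_\alpha=\prod_{x\in Q_0}\mathrm{GL}_{\alpha(x)}(K)$ and $\mathrm{SL}_\alpha=\prod_{x\in Q_0}\mathrm{SL}_{\alpha(x)}(K)$. The group $\mathrm{GL}_\alpha$ acts on $\mathrm{Rep}(Q,\alpha)$ by $(A(x))_x\cdot (V(a))_a=(A(ha)V(a)A(ta)^{-1})_a$, and on polynomial functions by $(A\cdot f)(V)=f(A^{-1}\cdot V)$.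 The ring of semi-invariants is $\mathrm{SI}(Q,\alpha)=K[\mathrm{Rep}(Q,\alpha)]^{\mathrm{SL}_\alpha}$. A weight is a function $\sigma:Q_0\to\mathbb{Z}$; put $\chi_\sigma(A)=\prod_x\det(A(x))^{\sigma(x)}$ and $\mathrm{SI}(Q,\alpha)_\sigma=\{f\in K[\mathrm{Rep}(Q,\alpha)] : A\cdot f=\chi_\sigma(A)f\ \forall A\in\mathrm{GL}_\alpha\}$. One has $\mathrm{SI}(Q,\alpha)=\bigoplus_\sigma \mathrm{SI}(Q,\alpha)_\sigma$, and $\mathrm{SI}(Q,\alpha)_\sigma=0$ unless $\sigma\cdot\alpha:=\sum_x\sigma(x)\alpha(x)=0$. For $\sigma\cdot\alpha=0$, set $|\sigma|_\alpha=\sigma_+\cdot\alpha=\sigma_-\cdot\alpha$, where $\sigma_+(x)=\max\{\sigma(x),0\}$ and $\sigma_-(x)=\max\{-\sigma(x),0\}$. $\|\alpha\|_1=\sum_{x\in Q_0}|\alpha(x)|$. The null cone $\mathcal N\subseteq\mathrm{Rep}(Q,\alpha)$ is the common zero set of all non-constant homogeneous (with respect to total polynomial degree) elements of $\mathrm{SI}(Q,\alpha)$.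
   Formalization: The dimension vector is assumed positive at every vertex; if α(x)=0, the indicator weight of x is nonzero with |σ|_α=0 and has 1 as a semi-invariant, so the stated common zero set is empty while 0 lies in the null cone. *)

(* Defs.v *)
From HB Require Import structures.
From mathcomp Require Import all_boot all_order all_algebra.
From mathcomp Require Import mpoly.

Set Implicit Arguments.
Unset Strict Implicit.
Unset Printing Implicit Defensive.

Import Order.TTheory GRing.Theory Num.Theory.
Local Open Scope ring_scope.

Definition infinite_field (K : fieldType) : Prop :=
  forall s : seq K, exists x, x \notin s.

Record quiver := Quiver {
  vertex : finType;
  arrow : finType;
  ta : arrow -> vertex;
  ha : arrow -> vertex }.

(* [cycle] holds of the empty sequence, and of [:: a] iff [a] is a loop. *)
Definition no_oriented_cycles (Q : quiver) : Prop :=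
  forall p : seq (arrow Q), cycle [rel a b | ha a == ta b] p -> p = [::].

Definition dimvec (Q : quiver) := {ffun vertex Q -> nat}.

Definition weight (Q : quiver) := {ffun vertex Q -> int}.

(* The null cone theorem needs alpha(x) > 0 at every vertex.  If alpha(x) = 0,
   the indicator sigma of x is a nonzero weight with |sigma|_alpha = 0 and
   chi_sigma = 1, so 1 is a semi-invariant of weight sigma and the semi-invariants
   of nonzero weight have no common zero, whereas 0 is in the null cone. *)
Definition sincere (Q : quiver) (alpha : dimvec Q) : Prop :=
  forall x, (0 < alpha x)%N.

Definition norm1 (Q : quiver) (alpha : dimvec Q) : nat :=
  (\sum_x alpha x)%N.

Definition wdot (Q : quiver) (sigma : weight Q) (alpha : dimvec Q) : int :=
  \sum_x sigma x * (alpha x)%:Z.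

Definition wpos (Q : quiver) (sigma : weight Q) : weight Q :=
  [ffun x => Num.max (sigma x) 0].

(* |sigma|_alpha, meant for weights with wdot sigma alpha = 0. *)
Definition wsize (Q : quiver) (sigma : weight Q) (alpha : dimvec Q) : int :=
  wdot (wpos sigma) alpha.

Section Representations.
Variables (K : fieldType) (Q : quiver) (alpha : dimvec Q).

Definition Rep := forall a : arrow Q, 'M[K]_(alpha (ha a), alpha (ta a)).

Definition matfam := forall x : vertex Q, 'M[K]_(alpha x).

Definition in_GL (A : matfam) : Prop := forall x, A x \in unitmx.

Definition in_SL (A : matfam) : Prop := forall x, \det (A x) = 1.

Definition matfam_inv (A : matfam) : matfam := fun x => invmx (A x).

Definition act (A : matfam) (V : Rep) : Rep :=
  fun a => A (ha a) *m V a *m invmx (A (ta a)).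

Definition chi (sigma : weight Q) (A : matfam) : K :=
  \prod_x \det (A x) ^ sigma x.

Definition entry : finType :=
  {a : arrow Q & ('I_(alpha (ha a)) * 'I_(alpha (ta a)))%type}.

(* K[Rep(Q, alpha)], one variable per matrix entry; over an infinite field
   polynomials and polynomial functions are the same. *)
Definition polyRep := {mpoly K[#|entry|]}.

Definition rep_coord (V : Rep) (i : 'I_#|entry|) : K :=
  let c : entry := enum_val i in V (tag c) (tagged c).1 (tagged c).2.

Definition peval (f : polyRep) (V : Rep) : K := f.@[rep_coord V].

(* The polynomial function A . f. *)
Definition pact (A : matfam) (f : polyRep) (V : Rep) : K :=
  peval f (act (matfam_inv A) V).

Definition SI (f : polyRep) : Prop :=
  forall A, in_SL A -> forall V, pact A f V = peval f V.

Definition SI_weight (sigma : weight Q) (f : polyRep) : Prop :=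
  forall A, in_GL A -> forall V, pact A f V = chi sigma A * peval f V.

Definition is_const (f : polyRep) : Prop := exists c : K, f = c%:MP.

Definition is_homogeneous (f : polyRep) : Prop := exists d, f \is d.-homog.

Definition null_cone (V : Rep) : Prop :=
  forall f, SI f -> is_homogeneous f -> ~ is_const f -> peval f V = 0.

End Representations.

(* Main.v *)
(** If a semi-invariant does not vanish at [V], splitting it into torus weights
    and testing it on one-parameter subgroups gives a nonzero weight [sigma] for
    which [V] is semistable: [sigma . alpha = 0] and [sigma . dim W <= 0] for all
    subrepresentations [W].  Such weights form a pointed polyhedral cone.  On an
    extremal ray, [sigma] is determined by the dimension vectors of the tight
    subrepresentations, and by a Jordan-Hoelder argument in their modular lattice
    by [n - 1] vectors whose sum is at most [alpha]; Cramer's rule and the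
    inequality of arithmetic and geometric means bound it by
    [2 |sigma|_alpha (n - 1)^(n - 1) <= |alpha|^n].
    Put [N = |sigma|_alpha].  The walks in [Q] span a space of [N x N] matrices
    from the sum of the [V(x)^sigma_+(x)] to the sum of the [V(y)^sigma_-(y)], and
    semistability says that no subspace of the source is mapped into a subspace of
    smaller dimension.  Hence some linear combination of the walks with
    [N x N]-matrix coefficients is invertible; its determinant is a semi-invariant
    of weight [N sigma] which does not vanish at [V], and [|N sigma|_alpha = N^2].
    The existence of this combination rests on the regularity lemma for matrix
    spaces, the reduction of the size of blow-ups, and Wong sequences. *)

Require Import Defs.
From HB Require Import structures.
From mathcomp Require Import all_boot all_order all_algebra.
From mathcomp Require Import perm generic_quotient mpoly mxtens.
From mathcomp Require Import zify ring lra.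
From Stdlib Require Import Classical ClassicalEpsilon.

Set Implicit Arguments.
Unset Strict Implicit.
Unset Printing Implicit Defensive.

Import Order.TTheory GRing.Theory Num.Theory.
Local Open Scope ring_scope.

(** * Rank, infinite fields and fraction fields *)

(** Matrix coefficients cannot be avoided: every alternating 3 x 3 matrix is singular, although the
    space of these matrices shrinks no subspace. What forces large blow-ups to reach full rank is
    regularity, usually deduced from generic division algebras. Here the generic coefficients are
    twisted so that a cyclic shift of their entries becomes conjugation by a [d]-th root of ['X].
    The corank of the generic blow-up is then the exponent of a power of ['X] that is a norm, and a
    comparison of degrees decides. Acyclicity enters in three places, each time through [height]: it
    makes the cone of weights pointed, it lets a one-parameter subgroup contract every
    representation to 0, and it bounds the length of nonzero walks. *)

Lemma rank_minor (F : fieldType) m n r (M : 'M[F]_(m, n)) :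
  (r <= \rank M)%N ->
  exists (f : 'I_r -> 'I_m) (g : 'I_r -> 'I_n), \det (mxsub f g M) != 0.
Proof.
move=> le_r; pose f := maxrankfun M \o widen_ord le_r.
have freeA : row_free (rowsub f M).
  rewrite rowsub_comp; apply/row_freeP.
  have /row_freeP [B MB] := maxrowsub_free M.
  exists (colsub (widen_ord le_r) B).
  rewrite -mxsub_mul MB; apply/matrixP=> i j; rewrite !mxE.
  by congr (_%:R).
have fullA : row_full (rowsub f M)^T by rewrite /row_full mxrank_tr.
exists f, (fullrankfun fullA); rewrite -unitfE -[_ \is a _]/(_ \in unitmx).
rewrite -row_free_unit -[mxsub _ _ _]trmxK /row_free mxrank_tr trmx_mxsub.
rewrite mxsubrc -trmx_mxsub.
by have /eqP := mxrank_fullrowsub fullA => ->.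
Qed.

Lemma minor_rank (F : fieldType) m n r (M : 'M[F]_(m, n))
    (f : 'I_r -> 'I_m) (g : 'I_r -> 'I_n) :
  \det (mxsub f g M) != 0 -> (r <= \rank M)%N.
Proof.
rewrite -unitfE -[_ \is a _]/(_ \in unitmx) -row_free_unit => /eqP {1}<-.
rewrite mxsubrc (leq_trans (mxrankS (rowsub_sub _ _)))//.
rewrite -[\rank (colsub _ _)]mxrank_tr -[\rank M]mxrank_tr trmx_mxsub.
exact: mxrankS (rowsub_sub _ _).
Qed.

Section InfiniteField.
Variables (K : fieldType) (hK : infinite_field K).

Lemma infinite_uniq n : exists s : seq K, [/\ uniq s, size s = n & 0 \notin s].
Proof.
elim: n => [|n [s [us ss s0]]]; first by exists [::].
have [x] := hK (0 :: s); rewrite inE negb_or => /andP[x0 xs].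
exists (x :: s); split; rewrite /= ?xs ?ss //.
by rewrite inE negb_or eq_sym x0.
Qed.

Lemma poly_nonroot (p : {poly K}) : p != 0 -> exists2 x, x != 0 & p.[x] != 0.
Proof.
move=> p0; have [s [us ss s0]] := infinite_uniq (size p).
have /allPn[x xs px] : ~~ all (root p) s.
  by apply/negP => /(max_poly_roots p0)/(_ us); rewrite ss ltnn.
by exists x => //; apply: contraNneq s0 => <-.
Qed.

Lemma poly_eq0_nonzero (p : {poly K}) : (forall x, x != 0 -> p.[x] = 0) -> p = 0.
Proof.
move=> h; apply/eqP/negPn/negP => /poly_nonroot[x x0].
by rewrite h ?eqxx.
Qed.

Lemma expz_neq (a b : int) : a != b -> exists2 u : K, u != 0 & u ^ a != u ^ b.
Proof.
wlog lt_ab : a b / a < b => [H ab|_].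
  have [/H|/H|] := ltgtP a b; last by move/eqP; rewrite (negPf ab).
    exact.
  by rewrite eq_sym => /(_ ab)[u u0 h]; exists u; rewrite // eq_sym.
have [k ->] : exists k : nat, b = a + k.+1%:Z.
  exists `|b - a|.-1; lia.
have p0 : 'X^(k.+1) - 1 != 0 :> {poly K} by rewrite -size_poly_eq0 size_XnsubC.
have [u u0 hu] := poly_nonroot p0; exists u => //.
apply: contra hu => /eqP h; rewrite !hornerE subr_eq0.
have ua : u ^ a != 0 by rewrite expfz_neq0.
by apply/eqP/(mulfI ua); rewrite mulr1 [RHS]h expfzDr.
Qed.

(* Dedekind's argument: the relation at [t0 * t] minus [chi_w t0] times the
   relation at [t] no longer involves [chi_w]. *)
Lemma char_indep (I : finType) (ws : seq {ffun I -> int})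
    (c : {ffun I -> int} -> K) :
  uniq ws ->
  (forall t : I -> K, (forall i, t i != 0) ->
     \sum_(w <- ws) c w * \prod_i t i ^ w i = 0) ->
  forall w, w \in ws -> c w = 0.
Proof.
elim: ws c => [|w ws IH] c //= /andP[wws uws] h.
have tail w' : w' \in ws -> c w' = 0.
  move=> w'ws; have ww' : w != w' by apply: contraNneq wws => ->.
  have [x hx] : exists x, w x != w' x.
    apply/existsP; apply: contraNT ww'; rewrite negb_exists => /forallP e.
    by apply/eqP/ffunP => x; apply/eqP; rewrite -[_ == _]negbK.
  have [u u0 hu] := expz_neq hx.
  pose t0 i := if i == x then u else 1.
  have t00 i : t0 i != 0 by rewrite /t0; case: ifP; rewrite ?oner_eq0.
  pose chi (t : I -> K) (v : {ffun I -> int}) := \prod_i t i ^ v i.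
  have chi0 v : chi t0 v = u ^ v x.
    rewrite /chi (bigD1 x) //= /t0 eqxx big1 ?mulr1 // => i /negPf ->.
    by rewrite exp1rz.
  suff /IH -/(_ uws w' w'ws)/eqP : forall t, (forall i, t i != 0) ->
      \sum_(v <- ws) (c v * (chi t0 v - chi t0 w)) * \prod_i t i ^ v i = 0.
    rewrite mulf_eq0 subr_eq0 !chi0 => /orP[/eqP //|].
    by rewrite eq_sym (negPf hu).
  move=> t ht; have := h t ht.
  have /h : forall i, t0 i * t i != 0 by move=> i; rewrite mulf_neq0.
  rewrite !big_cons => e1 e2.
  have chiM (v : {ffun I -> int}) : \prod_i (t0 i * t i) ^ v i = chi t0 v * chi t v.
    by rewrite /chi -big_split; apply: eq_bigr => i _; rewrite exprzMl ?unitfE.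
  move: e1; rewrite chiM.
  under eq_bigr => v _ do rewrite chiM.
  move=> e1; transitivity (\sum_(v <- ws) c v * (chi t0 v * chi t v) -
    chi t0 w * \sum_(v <- ws) c v * chi t v).
    rewrite mulr_sumr -sumrB; apply: eq_bigr => v _; rewrite -/(chi t v); ring.
  move/eqP: e1; rewrite addrC addr_eq0 => /eqP ->.
  move/eqP: e2; rewrite addrC addr_eq0 => /eqP ->.
  rewrite -/(chi t w); ring.
move=> v; rewrite inE => /orP[/eqP ->|]; last exact: tail.
have := h (fun=> 1) (fun=> oner_neq0 _).
rewrite big_cons [X in _ + X]big_seq [X in _ + X]big1 => [|w' w'ws]; last first.
  by rewrite (tail _ w'ws) mul0r.
by rewrite addr0 big1 ?mulr1 // => i _; rewrite exp1rz.
Qed.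

(** Monomials are characters of the torus with natural exponents, so Dedekind independence replaces
    an induction on the number of variables. *)
Lemma mpoly_nonvanishing n (p : {mpoly K[n]}) : p != 0 -> exists v, p.@[v] != 0.
Proof.
move=> p0; apply: NNPP => nv.
have pv v : p.@[v] = 0 by apply/eqP/negPn/negP => h; apply: nv; exists v.
pose z (m : 'X_{1..n}) : {ffun 'I_n -> int} := [ffun i => (m i)%:Z].
have zinj : injective z.
  move=> m1 m2 /ffunP e; apply/mnmP => i; have := e i; rewrite !ffunE.
  by case.
pose zi (w : {ffun 'I_n -> int}) : 'X_{1..n} := [multinom `|w i|%N | i < n].
have zK m : zi (z m) = m by apply/mnmP => i; rewrite mnmE ffunE.
have h t : (forall i, t i != 0) ->
    \sum_(w <- map z (msupp p)) p@_(zi w) * \prod_i t i ^ w i = 0.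
  move=> _; rewrite big_map -[RHS](pv t) mevalE; apply: eq_bigr => m _.
  by rewrite zK; congr (_ * _); apply: eq_bigr => i _; rewrite ffunE.
have um : uniq (map z (msupp p)) by rewrite map_inj_uniq // msupp_uniq.
case/negP: p0; apply/eqP/mpolyP => m; rewrite mcoeff0.
have [ms|] := boolP (m \in msupp p); last by rewrite -mcoeff_eq0 => /eqP.
by rewrite -[m in LHS]zK (char_indep um h) // map_f.
Qed.

End InfiniteField.

(** * Injective endomorphisms on fraction fields, and degrees of norms *)

Section FractionMap.
Variables (R : idomainType) (f : {rmorphism R -> R}) (f_inj : injective f).
Local Notation "x %:F" := (@FracField.tofrac R x).
Local Notation num x := (\n_(repr x)).
Local Notation den x := (\d_(repr x)).

Lemma fraction_repr (x : {fraction R}) : x = (num x)%:F / (den x)%:F.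
Proof.
have d0 := denom_ratioP (repr x).
have d1 : (den x)%:F != 0 by rewrite tofrac_eq0.
apply: (mulIf d1); rewrite mulfVK //.
rewrite -{1}[x]reprK -{1}[repr x]Ratio_numden; unlock FracField.tofrac.
rewrite -[LHS]FracField.pi_mul; apply/eqmodP => /=.
rewrite FracField.equivfE /FracField.mulf.
by rewrite !numden_Ratio ?oner_eq0 ?mulr1 ?mulf_neq0 // mulrC.
Qed.

(** Injectivity keeps denominators nonzero; its proof is an argument so that the ring morphism
    structure can be attached to the term. *)
Definition fraction_map (_ : injective f) (x : {fraction R}) : {fraction R} :=
  (f (num x))%:F / (f (den x))%:F.

Local Notation fmap := (fraction_map f_inj).

Let f_neq0 x : x != 0 -> f x != 0.
Proof. by apply: contra => /eqP h; apply/eqP/f_inj; rewrite h rmorph0. Qed.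

Lemma fraction_map_div n d : d != 0 ->
  fmap (n%:F / d%:F) = (f n)%:F / (f d)%:F.
Proof.
move=> d0; rewrite /fraction_map.
move: (fraction_repr (n%:F / d%:F)) (denom_ratioP (repr (n%:F / d%:F))).
move: (num _) (den _) => n' d' /eqP e d'0; move: e.
rewrite eqr_div ?tofrac_eq0 // -!tofracM tofrac_eq => /eqP h.
apply/eqP; rewrite eqr_div ?tofrac_eq0 ?f_neq0 // -!tofracM tofrac_eq.
by rewrite -!rmorphM h.
Qed.

Lemma fraction_map_tofrac x : fmap x%:F = (f x)%:F.
Proof.
have := fraction_map_div x (oner_neq0 R).
by rewrite !rmorph1 !divr1.
Qed.

Lemma fraction_map_zmod_morphism : zmod_morphism fmap.
Proof.
move=> x y; rewrite {1}[x]fraction_repr {1}[y]fraction_repr.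
have dx := denom_ratioP (repr x); have dy := denom_ratioP (repr y).
rewrite -mulNr addf_div ?tofrac_eq0 //.
rewrite -tofracN -!tofracM -tofracD fraction_map_div ?mulf_neq0 //.
rewrite /fraction_map -mulNr addf_div ?tofrac_eq0 ?f_neq0 //.
by rewrite rmorphD !rmorphM /= !rmorphN /= ?tofracD ?tofracM ?tofracN.
Qed.

Lemma fraction_map_monoid_morphism : monoid_morphism fmap.
Proof.
split=> [|x y]; first by rewrite -tofrac1 fraction_map_tofrac rmorph1.
rewrite {1}[x]fraction_repr {1}[y]fraction_repr.
have dx := denom_ratioP (repr x); have dy := denom_ratioP (repr y).
rewrite mulf_div -!tofracM fraction_map_div ?mulf_neq0 //.
by rewrite /fraction_map mulf_div !rmorphM.
Qed.

HB.instance Definition _ := GRing.isZmodMorphism.Build {fraction R} {fraction R}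
  fmap fraction_map_zmod_morphism.
HB.instance Definition _ := GRing.isMonoidMorphism.Build {fraction R} {fraction R}
  fmap fraction_map_monoid_morphism.

Lemma iter_fraction_map_id d : (forall r, iter d f r = r) ->
  forall x, iter d fmap x = x.
Proof.
move=> fd x; have e n r : iter d fmap (n%:F / r%:F) =
    (iter d f n)%:F / (iter d f r)%:F.
  elim: d {fd} => // d IH.
  by rewrite !iterS IH rmorphM fmorphV /= !fraction_map_tofrac.
by rewrite {1}[x]fraction_repr e !fd -fraction_repr.
Qed.
End FractionMap.

Section DegreeNorm.
Variables (S : idomainType) (f : {rmorphism {poly S} -> {poly S}}).
Hypothesis f_inj : injective f.
Hypothesis size_f : forall p, size (f p) = size p.
Local Notation R := {poly S}.
Local Notation "x %:F" := (@FracField.tofrac R x).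
Local Notation F := {fraction R}.
Local Notation sigma := (fraction_map f_inj).
Let sigmaE x : sigma x%:F = (f x)%:F := fraction_map_tofrac f_inj x.

(** The degree of a fraction, numerator minus denominator, is unchanged by [sigma], so the product
    of [d] conjugates of [c] has [d] times the degree of [c]. *)
Lemma dvdn_degree_norm d' (c : F) u (d := d'.+1) :
  \prod_(i < d) iter i sigma c = ('X%:F) ^+ u -> (d %| u)%N.
Proof.
rewrite [c]fraction_repr; move: (denom_ratioP (repr c)).
move: (\n_(repr c)) (\d_(repr c)) => n e e0.
have it i (a : R) : iter i sigma a%:F = (iter i f a)%:F.
  by elim: i => // i IH; rewrite !iterS IH sigmaE.
have itd i (a b : R) : iter i sigma (a%:F / b%:F) = (iter i f a)%:F / (iter i f b)%:F.
  by rewrite -!it; elim: i => // i IH; rewrite !iterS IH rmorphM fmorphV.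
have f_neq0 i (a : R) : a != 0 -> iter i f a != 0.
  move=> a0; elim: i => // i IH; rewrite iterS -(rmorph0 f).
  by rewrite (inj_eq f_inj).
have sz i (a : R) : size (iter i f a) = size a.
  by elim: i => // i IH; rewrite iterS size_f.
have szp (a : R) : a != 0 -> (size (\prod_(i < d) iter i f a)).-1 = (d * (size a).-1)%N.
  move=> a0; rewrite size_prod => [|i _]; last exact: f_neq0.
  under eq_bigr => i _ do rewrite sz.
  rewrite sum_nat_const card_ord; have : (0 < size a)%N by rewrite size_poly_gt0.
  case: (size a) => // k _ /=; lia.
under eq_bigr => i _ do rewrite itd.
have pe0 : \prod_(i < d) iter i f e != 0.
  by apply/prodf_neq0 => i _; apply: f_neq0.
have pe1 : (\prod_(i < d) iter i f e)%:F != 0 by rewrite tofrac_eq0.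
rewrite prodf_div -!rmorph_prod -rmorphXn => /eqP.
rewrite (can2_eq (divfK pe1) (mulfK pe1)) -rmorphM tofrac_eq => /eqP h.
have n0 : n != 0.
  apply: contraTneq isT => n0; have := h; rewrite n0.
  rewrite (bigD1 ord0) //= mul0r => /esym/eqP.
  by rewrite mulf_eq0 (negPf pe0) orbF expf_eq0 polyX_eq0 andbF.
have := szp _ n0; rewrite h mulrC size_mulXn // -subn1 => e1.
have := szp _ e0; have : (0 < size (\prod_(i < d) iter i f e)%R)%N.
  by rewrite size_poly_gt0.
move: e1; case: (size (\prod_(i < d) iter i f e)%R) => // k; rewrite addnS subn1 /= => e1 _ e2.
have : (d %| u + k)%N by rewrite e1 dvdn_mulr.
by rewrite e2 dvdn_addl ?dvdn_mulr.
Qed.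

End DegreeNorm.

(** * Regularity of blow-ups *)

Definition blowup (R : pzRingType) (L : finType) d d' N N'
    (T : L -> 'M[R]_(d, d')) (X : L -> 'M[R]_(N, N')) : 'M[R]_(d * N, d' * N') :=
  \sum_l tensmx (T l) (X l).

Lemma map_blowup (R S : pzRingType) (f : {rmorphism R -> S}) (L : finType)
    d d' N N' (T : L -> 'M[R]_(d, d')) (X : L -> 'M[R]_(N, N')) :
  map_mx f (blowup T X) = blowup (fun l => map_mx f (T l)) (fun l => map_mx f (X l)).
Proof. by rewrite /blowup map_mx_sum; apply: eq_bigr => l _; rewrite map_mxT. Qed.

Lemma eq_blowup (R : pzRingType) (L : finType) d d' N N'
    (T T' : L -> 'M[R]_(d, d')) (X X' : L -> 'M[R]_(N, N')) :
  T =1 T' -> X =1 X' -> blowup T X = blowup T' X'.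
Proof. by move=> eT eX; apply: eq_bigr => l _; rewrite eT eX. Qed.

(** Balances the exponents of ['X] when a generic matrix is commuted past [cyclic_mx 'X 1]: the
    carries modulo [d] compensate the change of order of the shifted indices. *)
Lemma succ_divn d i j : (i < d)%N -> (j < d)%N ->
  ((j < i) + (j + 1) %/ d = (i + 1) %/ d + ((j + 1) %% d < (i + 1) %% d))%N.
Proof.
move=> li lj; have d0 : (0 < d)%N by apply: leq_ltn_trans li.
have e k : (k < d)%N -> ((k + 1) %/ d = (k.+1 == d) /\
    (k + 1) %% d = if k.+1 == d then 0 else k.+1)%N.
  rewrite addn1; case: eqP => [->|/eqP kd lk]; first by rewrite divnn modnn d0.
  by rewrite divn_small ?modn_small // ltn_neqAle kd.
have [-> ->] := e _ li; have [-> ->] := e _ lj.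
case: eqP => ei; case: eqP => ej //=; lia.
Qed.

Lemma tensmx_scalar1 (S : comPzRingType) m n (c : S) : tensmx (c%:M : 'M_m) (1%:M : 'M_n) = c%:M.
Proof.
apply/matrixP => i j; rewrite -[i]mxtens_unindexK -[j]mxtens_unindexK.
case: (mxtens_unindex i) (mxtens_unindex j) => [a b] [a' b'].
rewrite tensmxE !mxE (can_eq (@mxtens_indexK _ _)) xpair_eqE.
by rewrite mulr_natr -mulrnA mulnb.
Qed.

Section CyclicMatrix.
Variables (R : comPzRingType) (d' : nat).
Local Notation d := d'.+1.

(* The powers of the companion matrix of ['X^d - t]. *)
Definition cyclic_mx (t : R) k : 'M[R]_d :=
  \matrix_(i, j) ((t ^+ ((i + k) %/ d)%N) *+ (j == (i + k) %% d :> nat)%N).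

Lemma cyclic_mx_mul t k n (M : 'M[R]_(d, n)) i j :
  (cyclic_mx t k *m M) i j = t ^+ ((i + k) %/ d)%N * M (inord ((i + k) %% d)%N) j.
Proof.
rewrite mxE (bigD1 (inord ((i + k) %% d)%N)) //= mxE inordK ?ltn_mod // eqxx mulr1n.
rewrite big1 ?addr0 // => l hl; rewrite mxE.
case: eqP => [e|_]; last by rewrite mul0r.
by case/eqP: hl; rewrite -e inord_val.
Qed.

Lemma cyclic_mxS t k : cyclic_mx t k.+1 = cyclic_mx t k *m cyclic_mx t 1%N.
Proof.
apply/matrixP => i j; rewrite cyclic_mx_mul !mxE inordK ?ltn_mod //.
have -> : (i + k.+1 = (i + k) %/ d * d + ((i + k) %% d + 1))%N.
  by rewrite addnS {1}(divn_eq (i + k) d) addn1 addnS.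
by rewrite divnMDl // modnMDl exprD mulrnAr.
Qed.

Lemma cyclic_mx_order t : cyclic_mx t d = t%:M.
Proof.
apply/matrixP => i j; rewrite !mxE modnDr modn_small //.
by rewrite divnDr // divnn divn_small // add0n expr1 eq_sym.
Qed.

End CyclicMatrix.

(* The semilinear map [v |-> sigma v *m Z 1] preserves the row kernel of [A], and
   its [d]-th power is multiplication by [t].  So the determinant [c] of its
   matrix on the kernel has norm [t ^+ \dim ker A]. *)
Section SemilinearKernel.
Variables (F : fieldType) (sigma : {rmorphism F -> F}) (d n : nat) (t : F).
Variables (A : 'M[F]_n) (Z : nat -> 'M[F]_n).
Hypothesis sigma_order : forall x, iter d sigma x = x.
Hypothesis Z0 : Z 0%N = 1%:M.
Hypothesis ZS : forall k, Z k.+1 = Z k *m Z 1%N.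
Hypothesis Zd : Z d = t%:M.
Hypothesis sigma_Z : forall k, map_mx sigma (Z k) = Z k.
Hypothesis sigma_A : map_mx sigma A *m Z 1%N = Z 1%N *m A.

Lemma semilinear_kernel_norm :
  exists c, \prod_(i < d) iter i sigma c = t ^+ (n - \rank A).
Proof.
rewrite -mxrank_ker; pose B := row_base (kermx A).
have BA : B *m A = 0 by apply/sub_kermxP; rewrite eq_row_base.
have [C BC] : exists C, map_mx sigma B *m Z 1%N = C *m B.
  apply/submxP; rewrite eq_row_base; apply/sub_kermxP.
  by rewrite -mulmxA -sigma_A mulmxA -map_mxM BA map_mx0 mul0mx.
have [D [BD detD]] : exists D, map_mx (iter d sigma) B *m Z d = D *m B /\
    \det D = \prod_(i < d) iter i sigma (\det C).
  elim: (d) => [|k [D [BD detD]]].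
    exists 1%:M; rewrite big_ord0 det1; split=> //.
    by rewrite mul1mx Z0 mulmx1; apply/matrixP => i j; rewrite !mxE.
  exists (map_mx sigma D *m C); split.
    rewrite -mulmxA -BC mulmxA -map_mxM -BD map_mxM sigma_Z.
    rewrite -!mulmxA -ZS; congr (_ *m _).
    by apply/matrixP => i j; rewrite !mxE.
  rewrite det_mulmx det_map_mx detD big_ord_recl rmorph_prod mulrC.
  by congr (_ * _).
have Bid : map_mx (iter d sigma) B = B.
  by apply/matrixP => i j; rewrite mxE sigma_order.
exists (\det C); rewrite -detD -det_scalar; congr (\det _).
apply: (row_free_inj (row_base_free (kermx A))).
by rewrite -[LHS]BD Bid Zd mul_mx_scalar mul_scalar_mx.
Qed.

End SemilinearKernel.

Section Regularity.
Variables (K : fieldType) (hK : infinite_field K).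
Variables (L : finType) (N d' : nat) (X : L -> 'M[K]_N).
Local Notation d := d'.+1.
Local Notation I := (L * 'I_d * 'I_d)%type.
Local Notation S := {mpoly K[#|{: I}|]}.
Local Notation R := {poly S}.

Let shift (x : I) : I := (x.1.1, ordS x.1.2, ordS x.2).

Let shift_inj : injective (fun i : 'I_#|{: I}| => enum_rank (shift (enum_val i))).
Proof.
move=> i j /enum_rank_inj; move: (enum_val i) (enum_val j) (@enum_val_inj _ _ i j).
move=> [[l a] b] [[l' a'] b'] inj e; apply: inj.
have e1 : l = l' := congr1 (fun x : I => x.1.1) e.
have /(can_inj (@ordSK _)) e2 : ordS a = ordS a' := congr1 (fun x : I => x.1.2) e.
have /(can_inj (@ordSK _)) e3 : ordS b = ordS b' := congr1 (fun x : I => x.2) e.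
by rewrite e1 e2 e3.
Qed.

Let sh : 'S_#|{: I}| := perm shift_inj.

Let shE l i j : sh (enum_rank (l, i, j)) = enum_rank (l, ordS i, ordS j).
Proof. by rewrite permE enum_rankK. Qed.

Let sh_order : (sh ^+ d)%g = 1%g.
Proof.
have ordS_iter k (i : 'I_d) : iter k (@ordS d) i = ((i + k) %% d)%N :> nat.
  elim: k => [|k IH]; first by rewrite addn0 modn_small.
  by rewrite iterS /= IH -addn1 modnDml addn1 addnS.
apply/permP => x; rewrite permX perm1 -[x]enum_valK.
case: (enum_val x) => [[l i] j].
have e k : iter k sh (enum_rank (l, i, j)) =
    enum_rank (l, iter k (@ordS d) i, iter k (@ordS d) j).
  by elim: k => // k IH; rewrite !iterS IH shE.
rewrite e; congr (enum_rank (_, _, _)); apply: ord_inj;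
  by rewrite ordS_iter modnDr modn_small.
Qed.

(** Shifts the matrix entries and fixes ['X], hence preserves degrees in ['X]. Together with
    [cyclic_mx 'X] it is the datum of a cyclic algebra, and the norm argument parallels the
    criterion for such an algebra to be a division algebra. *)
Let f : {rmorphism R -> R} := map_poly (msym sh).

Let f_iter k p : iter k f p = map_poly (msym (sh ^+ k)%g) p.
Proof.
elim: k => [|k IH] /=.
  by apply/polyP => i; rewrite coef_map /= expg0 msym1m.
rewrite IH; apply/polyP => i; rewrite !coef_map /=.
by rewrite expgSr msymMm.
Qed.

Let f_iter_id p : iter d f p = p.
Proof.
by rewrite f_iter sh_order; apply/polyP => i; rewrite coef_map /= msym1m.
Qed.

Let f_inj : injective f.
Proof. by apply: map_inj_poly; [apply: inj_msym | rewrite rmorph0]. Qed.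

Let size_f p : size (f p) = size p.
Proof. by apply: size_map_inj_poly; [apply: inj_msym | rewrite rmorph0]. Qed.

Local Notation "x %:F" := (@FracField.tofrac R x).
Local Notation F := {fraction R}.
Let sigma : {rmorphism F -> F} := fraction_map f_inj.
Let sigmaE x : sigma x%:F = (f x)%:F := fraction_map_tofrac f_inj x.
Let sigma_order x : iter d sigma x = x := iter_fraction_map_id f_inj f_iter_id x.

(* The generic matrices are normalised so that the cyclic shift of the variables
   acts on them as conjugation by [cyclic_mx 'X 1]. *)
Let Tgen l : 'M[R]_d :=
  \matrix_(i, j) (('X_(enum_rank (l, i, j)))%:P * 'X^((j < i)%N)).
Let XR l : 'M[R]_N := map_mx (polyC \o @mpolyC _ K) (X l).
Let Agen : 'M[R]_(d * N) := blowup Tgen XR.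

Let f_Tgen l : map_mx f (Tgen l) *m cyclic_mx d' 'X 1%N = cyclic_mx d' 'X 1%N *m Tgen l.
Proof.
apply/matrixP => i k; rewrite cyclic_mx_mul; have [j ->] : exists j, k = ordS j.
  by exists (ord_pred k); rewrite ord_predK.
have ordSE (a : 'I_d) : ordS a = ((a + 1) %% d)%N :> nat by rewrite addn1.
have -> : inord ((i + 1) %% d)%N = ordS i.
  by apply: ord_inj; rewrite inordK ?ltn_mod // ordSE.
rewrite mxE (bigD1 j) //= big1 => [|a aj]; last first.
  rewrite [X in _ * X]mxE -ordSE val_eqE (inj_eq (can_inj (@ordSK _))).
  by rewrite eq_sym (negPf aj) mulr0.
rewrite !mxE -ordSE eqxx addr0 mulr1n rmorphM /= map_polyC map_polyXn /=.
rewrite /msym mmapX mmap1U shE -mulrA -exprD mulrCA -exprD.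
by rewrite succ_divn // !addn1.
Qed.

Let f_Agen : map_mx f Agen *m tensmx (cyclic_mx d' 'X 1%N) 1%:M =
  tensmx (cyclic_mx d' 'X 1%N) 1%:M *m Agen.
Proof.
rewrite map_blowup mulmx_suml mulmx_sumr; apply: eq_bigr => l _.
rewrite !tensmx_mul f_Tgen mul1mx mulmx1; congr tensmx.
apply/matrixP => i j; rewrite !mxE /= map_polyC /= /msym.
by rewrite mmapC.
Qed.

Let A : 'M[F]_(d * N) := map_mx (@FracField.tofrac R) Agen.
Let Z k : 'M[F]_(d * N) :=
  map_mx (@FracField.tofrac R) (tensmx (cyclic_mx d' 'X k) 1%:M).

Let ZS k : Z k.+1 = Z k *m Z 1%N.
Proof. by rewrite -map_mxM tensmx_mul -cyclic_mxS mulmx1. Qed.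

Let sigma_map m n (M : 'M[R]_(m, n)) :
  map_mx sigma (map_mx (@FracField.tofrac R) M) =
  map_mx (@FracField.tofrac R) (map_mx f M).
Proof. by apply/matrixP => i j; rewrite !mxE; apply: sigmaE. Qed.

Let sigma_Z k : map_mx sigma (Z k) = Z k.
Proof.
rewrite sigma_map map_mxT map_mx1; congr (map_mx _ (tensmx _ _)).
apply/matrixP => i j; rewrite !mxE rmorphMn rmorphXn /=.
by rewrite map_polyX.
Qed.

Let sigma_A : map_mx sigma A *m Z 1%N = Z 1%N *m A.
Proof. by rewrite sigma_map -!map_mxM f_Agen. Qed.

(** Since ['X] to the power [d * N - \rank A] is a norm, [d] divides the corank, and therefore the
    rank: this is the regularity lemma. *)
Lemma dvdn_rank_generic : (d %| \rank A)%N.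
Proof.
have Z0 : Z 0%N = 1%:M.
  rewrite /Z; have -> : cyclic_mx d' 'X 0 = 1%:M :> 'M[R]_d.
    apply/matrixP => i j; rewrite !mxE addn0 divn_small // modn_small //.
    by rewrite eq_sym.
  by rewrite tensmx_scalar1 map_mx1.
have Zd : Z d = ('X%:F)%:M by rewrite /Z cyclic_mx_order tensmx_scalar1 map_scalar_mx.
have [c hc] := semilinear_kernel_norm sigma_order Z0 ZS Zd sigma_Z sigma_A.
have h := dvdn_degree_norm size_f hc.
by rewrite dvdn_subr ?rank_leq_row ?dvdn_mulr in h.
Qed.

Let spec (v : 'I_#|{: I}| -> K) t : {rmorphism R -> K} :=
  horner_eval t \o map_poly (meval v).

Let spec_Agen v t :
  map_mx (spec v t) Agen = blowup (fun l => map_mx (spec v t) (Tgen l)) X.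
Proof.
rewrite map_blowup; apply: eq_blowup => // l; apply/matrixP => i j.
by rewrite !mxE /= map_polyC /= mevalC horner_evalE hornerC.
Qed.

Let spec_rank v t : (\rank (map_mx (spec v t) Agen) <= \rank A)%N.
Proof.
have [g [h]] := rank_minor (leqnn (\rank (map_mx (spec v t) Agen))).
rewrite -map_mxsub det_map_mx => e; apply: (minor_rank (f := g) (g := h)).
rewrite -map_mxsub det_map_mx tofrac_eq0.
by apply: contraNneq e => ->; rewrite rmorph0.
Qed.

(** At ['X = 1] the normalising powers disappear and the entries are free, so every blow-up is a
    specialisation of the generic one. *)
Lemma rank_blowup_generic (T : L -> 'M[K]_d) : (\rank (blowup T X) <= \rank A)%N.
Proof.
pose v (k : 'I_#|{: I}|) : K := let x : I := enum_val k in T x.1.1 x.1.2 x.2.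
have := spec_rank v 1; apply: leq_trans; rewrite spec_Agen.
rewrite (eq_blowup (T' := fun l => map_mx (spec v 1) (Tgen l)) (X' := X)) // => l.
apply/matrixP => i j; rewrite !mxE rmorphM /= map_polyC map_polyXn /= mevalXU.
by rewrite !horner_evalE hornerC hornerXn expr1n mulr1 /v enum_rankK.
Qed.

Lemma rank_generic_blowup r : (r <= \rank A)%N ->
  exists T : L -> 'M[K]_d, (r <= \rank (blowup T X))%N.
Proof.
move=> /rank_minor [g [h]]; rewrite -map_mxsub det_map_mx tofrac_eq0.
set p := \det _ => p0.
(* Keeping the leading coefficient of the minor alive leaves a nonzero polynomial in ['X], for which
   [t] is chosen next. *)
have [v pv] : exists v, (lead_coef p).@[v] != 0.
  by apply: (mpoly_nonvanishing hK); rewrite lead_coef_eq0.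
have [t _ pt] : exists2 t, t != 0 & (map_poly (meval v) p).[t] != 0.
  apply: (poly_nonroot hK); apply: contraNneq pv => e.
  by rewrite lead_coefE -coef_map e coef0.
exists (fun l => map_mx (spec v t) (Tgen l)); rewrite -spec_Agen.
apply: (minor_rank (f := g) (g := h)).
by rewrite -map_mxsub det_map_mx.
Qed.

End Regularity.

(** The rank of a particular blow-up need not be a multiple of [d]; the generic rank is one, is at
    least as large, and is attained over an infinite field. *)
Lemma blowup_rank_divisible (K : fieldType) (hK : infinite_field K) (L : finType)
    N d (X : L -> 'M[K]_N) (T : L -> 'M[K]_d) s :
  (s * d < \rank (blowup T X))%N ->
  exists T' : L -> 'M[K]_d, (s.+1 * d <= \rank (blowup T' X))%N.
Proof.
case: d T => [|d] T h; first by exists T; rewrite muln0.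
apply: (rank_generic_blowup hK).
have := leq_trans h (rank_blowup_generic X T).
have /dvdnP[k ->] := dvdn_rank_generic d X.
by rewrite ltn_pmul2r // leq_pmul2r.
Qed.

(** * Reduction of blow-ups and non-commutative rank *)

Section BlowupReduction.
Variables (K : fieldType) (L : finType).

Lemma blowup_mulmx d1 d2 d3 N N' (S : 'M[K]_(d1, d2)) (T : L -> 'M[K]_(d2, d3))
    (X : L -> 'M[K]_(N, N')) :
  tensmx S 1%:M *m blowup T X = blowup (fun l => S *m T l) X.
Proof.
by rewrite mulmx_sumr; apply: eq_bigr => l _; rewrite tensmx_mul mul1mx.
Qed.

Lemma trmx_blowup d1 d2 N N' (T : L -> 'M[K]_(d1, d2)) (X : L -> 'M[K]_(N, N')) :
  (blowup T X)^T = blowup (fun l => (T l)^T) (fun l => (X l)^T).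
Proof.
rewrite /blowup raddf_sum /=; apply: eq_bigr => l _; exact: trmx_tens.
Qed.

(** Averaging over the [d.+1] block rows: one of them contains at most a [d.+1]-th part of a row
    basis, and deleting it loses no more rank than that. *)
Lemma blowup_row' d d' N N' (T : L -> 'M[K]_(d.+1, d')) (X : L -> 'M[K]_(N, N')) :
  exists j, (d * \rank (blowup T X) <=
             d.+1 * \rank (blowup (fun l => row' j (T l)) X))%N.
Proof.
set M := blowup T X; pose f := maxrankfun M.
pose fst_ix (x : 'I_(d.+1 * N)) := (mxtens_unindex x).1.
pose c j := #|[pred x | fst_ix (f x) == j]|.
have sum_c : (\sum_(j < d.+1) c j = \rank M)%N.
  rewrite -[RHS]card_ord -sum1_card.
  rewrite (partition_big (fun x => fst_ix (f x)) predT) //=.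
  by apply: eq_bigr => j _; rewrite sum1_card.
have [j cj] : exists j, (d.+1 * c j <= \rank M)%N.
  apply/existsP; apply: contraT; rewrite negb_exists => /forallP h.
  have : (\sum_(j < d.+1) d.+1 * c j > \sum_(j < d.+1) \rank M)%N.
    rewrite !big_ord_recl -addSn leq_add //; first by rewrite ltnNge h.
    by apply: leq_sum => i _; rewrite ltnW // ltnNge h.
  by rewrite -big_distrr /= sum_c sum_nat_const card_ord ltnn.
exists j; set M' := blowup _ _.
have sub : (M <= M' + \sum_(x | fst_ix (f x) == j) <<row (f x) M>>)%MS.
  rewrite -(eq_maxrowsub M); apply/row_subP => x; rewrite row_rowsub -/f.
  have [e|ne] := eqVneq (fst_ix (f x)) j.
    apply: submx_trans (addsmxSr _ _); apply: (sumsmx_sup x); first exact/eqP.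
    by rewrite genmxE.
  apply: submx_trans (addsmxSl _ _).
  have [a ea _] : {a | fst_ix (f x) = lift j a & unlift j (fst_ix (f x)) = Some a}.
    by apply: unlift_some; rewrite eq_sym.
  apply: (eq_row_sub (mxtens_index (a, (mxtens_unindex (f x)).2))).
  apply/rowP => k; rewrite !mxE !summxE; apply: eq_bigr => l _.
  by rewrite !mxE mxtens_indexK /= -ea.
have := mxrankS sub; move/leq_trans/(_ (mxrank_adds_leqif _ _).1).
have : (\rank (\sum_(x | fst_ix (f x) == j) <<row (f x) M>>)%MS <= c j)%N.
  apply: leq_trans (mxrank_sum_leqif _).1 _; rewrite /= /c -sum1_card.
  by apply: leq_sum => x _; rewrite genmxE rank_leq_row.
nia.
Qed.

(** For positive [s], deleting a block row and a block column keeps rank at least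
    [s * d ^ 2 / (d + 1)], which exceeds [(s - 1) * d] because [s <= d]. Regularity rounds this up
    to [s * d]. *)
Lemma blowup_rank_reduction (hK : infinite_field K) N d s (X : L -> 'M[K]_N)
    (T : L -> 'M[K]_d.+1) :
  (s <= d)%N -> (s * d.+1 <= \rank (blowup T X))%N ->
  exists T' : L -> 'M[K]_d, (s * d <= \rank (blowup T' X))%N.
Proof.
case: s => [|s] sd h.
  by exists (fun=> 0); rewrite mul0n.
have [i hi] := blowup_row' T X.
pose T1 l := (row' i (T l))^T.
have [j hj] := blowup_row' T1 (fun l => (X l)^T).
pose T2 l := (row' j (T1 l))^T.
apply: (blowup_rank_divisible hK (T := T2)).
have e1 : \rank (blowup (fun l => row' i (T l)) X) = \rank (blowup T1 (fun l => (X l)^T)).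
  by rewrite -mxrank_tr trmx_blowup.
have e2 : \rank (blowup (fun l => row' j (T1 l)) (fun l => (X l)^T)) =
    \rank (blowup T2 X).
  rewrite -mxrank_tr trmx_blowup; congr (\rank _).
  by apply: eq_blowup => l; rewrite ?trmxK.
move: hi hj h; rewrite e1 e2; set r0 := \rank (blowup T X).
move: r0 (\rank _) (\rank _) => r0 r2 r1; rewrite /= => hi hj h.
have le1 : (s.+1 * d <= r1)%N.
  rewrite -(leq_pmul2l (ltn0Sn d)) mulnCA; apply: leq_trans _ hi.
  by rewrite mulnA [leqRHS]mulnC leq_mul2r h orbT.
rewrite -(ltn_pmul2l (ltn0Sn d)); apply: leq_trans _ hj.
apply: leq_trans _ (leq_mul (leqnn d) le1).
nia.
Qed.

End BlowupReduction.

(** The sum is direct: a vector of [A i] lying in the sum of the others is both fixed and killed by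
    [P i]. *)
Lemma rank_sum_blocks (F : fieldType) (J : finType) n (q : J -> nat)
    (A : forall j, 'M[F]_(q j, n)) (P : J -> 'M[F]_n) :
  (forall i j, i != j -> A i *m P j = 0) -> (forall j, A j *m P j = A j) ->
  \rank (\sum_j <<A j>>)%MS = (\sum_j \rank (A j))%N.
Proof.
move=> A0 A1; transitivity (\sum_j \rank <<A j>>%MS)%N; last first.
  by apply: eq_bigr => j _; rewrite genmxE.
apply/eqP; change (mxdirect (\sum_j <<A j>>)%MS).
apply/mxdirect_sumsP => i _; set M := (_ :&: _)%MS.
have : (M <= A i)%MS by rewrite (submx_trans (capmxSl _ _)) ?genmxE.
case/submxP => C eM; rewrite eM -A1 mulmxA -eM; apply/eqP; rewrite -submx0.
apply: submx_trans (submxMr _ (capmxSr _ _)) _; rewrite sumsmxMr.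
apply/sumsmx_subP => j /= ji; rewrite (eqmxMr _ (genmxE _)).
by rewrite A0 ?sub0mx.
Qed.

(** Turns an existentially defined subspace such as [wong] into a row space, adjoining missing
    vectors until the codimension is used up. *)
Lemma subspace_matrix (F : fieldType) n (P : 'rV[F]_n -> Prop) :
  P 0 -> (forall u v, P u -> P v -> P (u + v)) -> (forall a u, P u -> P (a *: u)) ->
  exists Y : 'M[F]_n, forall y, (y <= Y)%MS <-> P y.
Proof.
move=> P0 PD PZ.
suff [Y [YP YM]] : exists Y : 'M[F]_n, (forall y, (y <= Y)%MS -> P y) /\
    (forall y, P y -> (y <= Y)%MS) by exists Y => y; split; auto.
have : exists Y : 'M[F]_n, forall y, (y <= Y)%MS -> P y.
  by exists 0 => y; rewrite submx0 => /eqP ->.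
case=> Y; move: {2}(n - \rank Y)%N (leqnn (n - \rank Y)) => k.
elim: k Y => [|k IH] Y hk YP.
  exists Y; split=> // y _; apply: submx_full.
  by rewrite row_full_unit -row_free_unit /row_free eqn_leq rank_leq_row -subn_eq0 -leqn0.
have [h|] := classic (forall y, P y -> (y <= Y)%MS); first by exists Y.
move=> /not_all_ex_not [y hy]; have [Py /negP nyY] := imply_to_and _ _ hy.
apply: (IH (Y + y)%MS).
  have : (Y < Y + y)%MS.
    by rewrite ltmxE addsmxSl addsmx_sub submx_refl.
  by rewrite ltmxErank => /andP[_]; move: (rank_leq_row (Y + y)%MS); lia.
move=> z /sub_addsmxP[[u v] /= ->].
apply: PD; first by apply: YP; apply: submxMl.
by rewrite [v]mx11_scalar mul_scalar_mx; apply: PZ.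
Qed.

(** * Wong sequences and shrunk subspaces *)

Section NoncommutativeRank.
Variables (K : fieldType) (hK : infinite_field K).
Variables (L : finType) (N : nat) (X : L -> 'M[K]_N).
Local Notation "T ^b" := (blowup T X) (at level 2, format "T ^b").

Let inl D d : 'M[K]_(D * N, (D + d) * N) := tensmx (row_mx 1%:M 0) 1%:M.
Let inr D d : 'M[K]_(d * N, (D + d) * N) := tensmx (row_mx 0 1%:M) 1%:M.
Let prl D d : 'M[K]_((D + d) * N, D * N) := tensmx (col_mx 1%:M 0) 1%:M.
Let prr D d : 'M[K]_((D + d) * N, d * N) := tensmx (col_mx 0 1%:M) 1%:M.

Let inl_prl D d : inl D d *m prl D d = 1%:M.
Proof. by rewrite tensmx_mul mul_row_col !mulmx1 mul0mx addr0 tensmx_scalar1. Qed.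

Let inr_prl D d : inr D d *m prl D d = 0.
Proof. by rewrite tensmx_mul mul_row_col mul0mx mulmx0 addr0 tens0mx. Qed.

Let inr_prr D d : inr D d *m prr D d = 1%:M.
Proof. by rewrite tensmx_mul mul_row_col !mulmx1 mul0mx add0r tensmx_scalar1. Qed.

Let inl_mul D d D' (S : L -> 'M[K]_(D, D')) (S' : L -> 'M[K]_(d, D')) :
  inl D d *m (fun l => col_mx (S l) (S' l))^b = S^b.
Proof.
rewrite blowup_mulmx; apply: eq_blowup => // l.
by rewrite mul_row_col mul1mx mul0mx addr0.
Qed.

Let inr_mul D d D' (S : L -> 'M[K]_(D, D')) (S' : L -> 'M[K]_(d, D')) :
  inr D d *m (fun l => col_mx (S l) (S' l))^b = S'^b.
Proof.
rewrite blowup_mulmx; apply: eq_blowup => // l.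
by rewrite mul_row_col mul1mx mul0mx add0r.
Qed.

Let blowup_row D d D' (S : L -> 'M[K]_(D', D)) (S' : L -> 'M[K]_(D', d)) :
  (fun l => row_mx (S l) (S' l))^b = S^b *m inl D d + S'^b *m inr D d.
Proof.
rewrite /blowup !mulmx_suml -big_split; apply: eq_bigr => l _ /=.
rewrite !tensmx_mul !mulmx1 !mul_mx_row !mulmx1 !mulmx0.
by apply/matrixP => i j; rewrite !mxE; case: splitP => k _; rewrite !mxE; ring.
Qed.

Let blowup_block D d D' d' (M : L -> 'M[K]_(D, D')) (G : L -> 'M[K]_(D, d'))
    (C : L -> 'M[K]_(d, D')) (A : L -> 'M[K]_(d, d')) :
  inl D d *m (fun l => block_mx (M l) (G l) (C l) (A l))^b =
    M^b *m inl D' d' + G^b *m inr D' d' /\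
  inr D d *m (fun l => block_mx (M l) (G l) (C l) (A l))^b =
    C^b *m inl D' d' + A^b *m inr D' d'.
Proof.
rewrite -!blowup_row.
split.
  by rewrite (inl_mul (fun l => row_mx (M l) (G l)) (fun l => row_mx (C l) (A l))).
by rewrite (inr_mul (fun l => row_mx (M l) (G l)) (fun l => row_mx (C l) (A l))).
Qed.

(** Rank is image plus kernel for the projection to the first block column. The image contains the
    rows of [M]; the kernel contains those of [A], and also [z *m G] because [z] kills [M]. *)
Lemma rank_block_triangular D d (M : L -> 'M[K]_D) (G : L -> 'M[K]_(D, d))
    (A : L -> 'M[K]_d) k (z : 'M[K]_(k, D * N)) : z *m M^b = 0 ->
  (\rank M^b + \rank (A^b + z *m G^b)%MS <=
   \rank (fun l => block_mx (M l) (G l) 0 (A l))^b)%N.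
Proof.
move=> zM; have [e1 e2] := blowup_block M G (fun=> 0) A.
set B := blowup _ X in e1 e2 *.
rewrite -(mxrank_mul_ker B (prl D d)) leq_add //.
  have : (inl D d *m B *m prl D d <= B *m prl D d)%MS by rewrite -mulmxA submxMl.
  move/mxrankS; rewrite e1 mulmxDl -!mulmxA inl_prl inr_prl mulmx0 addr0.
  by rewrite mulmx1.
have e2' : A^b *m inr D d = inr D d *m B.
  rewrite e2 [X in X *m _ + _]big1 ?mul0mx ?add0r // => l _.
  by rewrite tens0mx.
have e3 : z *m G^b *m inr D d = z *m inl D d *m B.
  by rewrite -[RHS]mulmxA e1 mulmxDr !mulmxA zM mul0mx add0r.
have free : row_free (inr D d) by apply/row_freeP; exists (prr D d).
rewrite -(mxrankMfree _ free) mxrankS // addsmxMr addsmx_sub !sub_capmx.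
rewrite e2' {1}e3 !submxMl /= !sub_kermx -e2' -!mulmxA inr_prl.
by rewrite !mulmx0 !eqxx.
Qed.

Variables (d r : nat) (A : L -> 'M[K]_d).
Hypothesis rankA : \rank A^b = (r * d)%N.
Hypothesis max_rank : forall e (T : L -> 'M[K]_e), (d <= e)%N -> (\rank T^b <= r * e)%N.

(* The union of the second Wong sequence of [A]: the chains of the sequence are
   recorded as kernel vectors of larger blow-ups. *)
Definition wong (y : 'rV[K]_(d * N)) : Prop :=
  exists D (M : L -> 'M[K]_D) (G : L -> 'M[K]_(D, d)) (z : 'rV[K]_(D * N)),
    [/\ (r * D <= \rank M^b)%N, z *m M^b = 0 & z *m G^b = y *m A^b].

Let blowup0 D D' : (fun _ : L => 0 : 'M[K]_(D, D'))^b = 0.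
Proof. by rewrite /blowup big1 // => l _; rewrite tens0mx. Qed.

Lemma wong_ker y : y *m A^b = 0 -> wong y.
Proof.
move=> yA; exists 0%N, (fun=> 0), (fun=> 0), 0.
by rewrite muln0 !mul0mx yA.
Qed.

Lemma wongD y1 y2 : wong y1 -> wong y2 -> wong (y1 + y2).
Proof.
move=> [D1 [M1 [G1 [z1 [r1 e1 f1]]]]] [D2 [M2 [G2 [z2 [r2 e2 f2]]]]].
exists (D1 + D2)%N, (fun l => block_mx (M1 l) 0 0 (M2 l)).
exists (fun l => col_mx (G1 l) (G2 l)), (z1 *m inl D1 D2 + z2 *m inr D1 D2); split.
- rewrite mulnDr (leq_trans (leq_add r1 r2)) //.
  have := rank_block_triangular (fun=> 0) M2 (mul0mx 1 M1^b).
  by apply: leq_trans; rewrite leq_add2l mxrankS // addsmxSl.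
- have [h1 h2] := blowup_block M1 (fun=> 0) (fun=> 0) M2.
  rewrite mulmxDl -!mulmxA h1 h2 !blowup0 !mul0mx addr0 add0r !mulmxA e1 e2.
  by rewrite !mul0mx addr0.
- by rewrite mulmxDl -!mulmxA inl_mul inr_mul f1 f2 mulmxDl.
Qed.

Lemma wongZ a y : wong y -> wong (a *: y).
Proof.
move=> [D [M [G [z [h1 h2 h3]]]]]; exists D, M, G, (a *: z).
by rewrite -!scalemxAl h2 h3 scaler0.
Qed.

(** One block [A] is appended to the witness: [(- z, y)] lies in the kernel of the enlarged matrix
    since [z] and [y] have the same image under [G] and [A], and against the new column [(0, B)] it
    yields the image of [y] under [B]. *)
Let wong_extend y (B : L -> 'M[K]_d) : wong y ->
  exists D (M : L -> 'M[K]_D) (G : L -> 'M[K]_(D, d)) (z : 'rV[K]_(D * N)),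
    [/\ (r * D <= \rank M^b)%N, z *m M^b = 0 & z *m G^b = y *m B^b].
Proof.
move=> [D [M [G [z [h1 h2 h3]]]]].
exists (D + d)%N, (fun l => block_mx (M l) (G l) 0 (A l)).
exists (fun l => col_mx 0 (B l)), (y *m inr D d - z *m inl D d).
have [e1 e2] := blowup_block M G (fun=> 0) A; split.
- rewrite mulnDr -rankA; apply: leq_trans (rank_block_triangular G A h2).
  by rewrite leq_add // mxrankS // addsmxSl.
- rewrite mulmxBl -!mulmxA e1 e2 blowup0 mul0mx add0r mulmxDr !mulmxA h2 h3.
  by rewrite mul0mx add0r subrr.
- by rewrite mulmxBl -!mulmxA inl_mul inr_mul blowup0 mulmx0 subr0.
Qed.

(** Maximality enters here: if the image of [y] left the row space of [A], a blow-up of size [D + d]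
    would have rank above [r * (D + d)]. *)
Lemma wong_step y (B : L -> 'M[K]_d) : wong y ->
  exists2 y', wong y' & y *m B^b = y' *m A^b.
Proof.
move=> /(wong_extend B)[D [M [G [z [h1 h2 h3]]]]].
have /submxP[y' ey'] : (y *m B^b <= A^b)%MS.
  apply: contraT => nle; have := max_rank (fun l => block_mx (M l) (G l) 0 (A l)).
  move=> /(_ (leq_addl _ _)); rewrite leqNgt => /negP[].
  apply: leq_trans (rank_block_triangular G A h2).
  rewrite h3 mulnDr -addnS leq_add // -rankA.
  have : (A^b < A^b + y *m B^b)%MS.
    by rewrite ltmxE addsmxSl addsmx_sub submx_refl.
  by rewrite ltmxErank => /andP[].
by exists y' => //; exists D, M, G, z; rewrite h3 ey'.
Qed.

Let E (i : 'I_d) : 'M[K]_(N, d * N) := \matrix_(k, x) (x == mxtens_index (i, k))%:R.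

Let mulE n (M : 'M[K]_(n, N)) i k a l :
  (M *m E i) k (mxtens_index (a, l)) = M k l *+ (a == i).
Proof.
rewrite mxE (bigD1 l) //= big1 ?addr0 => [|l' ll']; rewrite mxE (can_eq (@mxtens_indexK _ _)).
  by rewrite xpair_eqE eqxx andbT mulr_natr.
by rewrite xpair_eqE [l == l']eq_sym (negPf ll') andbF mulr0.
Qed.

Let mulET n (M : 'M[K]_(N, n)) i k a l :
  ((E i)^T *m M) (mxtens_index (a, k)) l = M k l *+ (a == i).
Proof.
transitivity ((M^T *m E i) l (mxtens_index (a, k))); last by rewrite mulE mxE.
by rewrite -{1}[M]trmxK -trmx_mul mxE.
Qed.

Let E_orth i j : i != j -> E i *m (E j)^T = 0.
Proof.
move=> ij; apply/matrixP => k l; rewrite mxE [RHS]mxE big1 // => x _.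
rewrite !mxE; case: eqP => [->|]; rewrite ?mul0r //.
by rewrite (can_eq (@mxtens_indexK _ _)) xpair_eqE (negPf ij) mulr0.
Qed.

Let E_norm i : E i *m (E i)^T = 1%:M.
Proof.
apply/matrixP => k l; rewrite -[_ *m _]trmxK trmx_mul trmxK mxE mxE.
rewrite (bigD1 (mxtens_index (i, l))) //= big1 ?addr0 => [|x hx]; rewrite !mxE.
  by rewrite eqxx mul1r (can_eq (@mxtens_indexK _ _)) xpair_eqE eqxx eq_sym.
by rewrite (negPf hx) mul0r.
Qed.

Let sumE : \sum_i (E i)^T *m E i = 1%:M.
Proof.
apply/matrixP => x y; rewrite -[x]mxtens_unindexK -[y]mxtens_unindexK.
case: (mxtens_unindex x) (mxtens_unindex y) => [a k] [b l].
rewrite summxE (bigD1 b) //= big1 ?addr0 => [|i ib].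
  by rewrite mulE eqxx !mxE.
by rewrite mulE eq_sym (negPf ib).
Qed.

Let E_blowup i j l : (E i)^T *m X l *m E j =
  (fun l' => if l' == l then delta_mx i j else 0)^b.
Proof.
rewrite /blowup (bigD1 l) //= eqxx big1 ?addr0 => [|l' /negPf ->]; last first.
  by rewrite tens0mx.
apply/matrixP => x y; rewrite -[x]mxtens_unindexK -[y]mxtens_unindexK.
case: (mxtens_unindex x) (mxtens_unindex y) => [a k] [b m].
rewrite mulE mulET tensmxE mxE.
by rewrite -mulrnA mulnb mulr_natl andbC.
Qed.

(** The Wong space [Y] contains the kernel of the blow-up of [A], so its image there has dimension
    [\rank Y - d * (N - r)]. All elementary coefficients map [Y] into this image; for the span [U]
    of the block components of [Y] and its image [W] this gives [d * \rank W < d * \rank U]. *)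
Lemma wong_shrunk : (r < N)%N -> (0 < d)%N ->
  exists U : 'M[K]_N, (\rank (\sum_l <<U *m X l>>)%MS < \rank U)%N.
Proof.
move=> rN d0; have w0 : wong 0 by apply: wong_ker; rewrite mul0mx.
have [Y hY] := subspace_matrix w0 wongD wongZ.
have kerY : (kermx A^b <= Y)%MS.
  apply/row_subP => i; apply/hY/wong_ker.
  by rewrite -row_mul mulmx_ker row0.
have stepY (B : L -> 'M[K]_d) : (Y *m B^b <= Y *m A^b)%MS.
  apply/row_subP => i; rewrite row_mul.
  have /(wong_step B)[y' /hY hy' ->] : wong (row i Y) by apply/hY; apply: row_sub.
  exact: submxMr.
pose U := (\sum_i <<Y *m (E i)^T>>)%MS; exists U.
set W := (\sum_l _)%MS.
have rkY : (\rank Y <= d * \rank U)%N.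
  have : (Y <= \sum_i <<U *m E i>>)%MS.
    rewrite -{1}[Y]mulmx1 -sumE mulmx_sumr; apply: summx_sub => i _.
    rewrite mulmxA (sumsmx_sup i) // genmxE submxMr //.
    by rewrite (sumsmx_sup i) // genmxE.
  move/mxrankS/leq_trans; apply.
  apply: leq_trans (mxrank_sum_leqif _).1 _; rewrite /=.
  rewrite -[d in leqRHS]card_ord -sum_nat_const leq_sum // => i _.
  by rewrite genmxE mxrankM_maxl.
have rkW : (d * \rank W <= \rank (Y *m A^b))%N.
  have -> : (d * \rank W = \rank (\sum_i <<W *m E i>>)%MS)%N.
    rewrite (rank_sum_blocks (P := fun i => (E i)^T *m E i)).
    - rewrite -[d in LHS]card_ord -sum_nat_const; apply: eq_bigr => i _.
      by rewrite mxrankMfree //; apply/row_freeP; exists (E i)^T.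
    - by move=> i j ij; rewrite -mulmxA (mulmxA (E i)) E_orth // mul0mx mulmx0.
    - by move=> i; rewrite -mulmxA (mulmxA (E i)) E_norm mul1mx.
  apply/mxrankS/sumsmx_subP => j _; rewrite genmxE /W sumsmxMr_gen.
  apply/sumsmx_subP => l _; rewrite genmxE (eqmxMr _ (genmxE _)) -mulmxA /U sumsmxMr_gen.
  apply/sumsmx_subP => i _; rewrite genmxE (eqmxMr _ (genmxE _)).
  by rewrite -mulmxA [_ *m (X l *m _)]mulmxA E_blowup stepY.
have := mxrank_mul_ker Y A^b.
have -> : \rank (Y :&: kermx A^b)%MS = (d * N - r * d)%N.
  rewrite -rankA -mxrank_ker; apply/eqmx_rank.
  by rewrite capmxSr sub_capmx kerY submx_refl.
nia.
Qed.

End NoncommutativeRank.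

(* Full non-commutative rank in the sense of Fortin and Reutenauer.  Descending
   from a large blow-up to one of size [N] keeps the weight quadratic in [N]. *)
Theorem blowup_invertible (K : fieldType) (hK : infinite_field K) (L : finType) N
    (X : L -> 'M[K]_N) :
  (forall U : 'M[K]_N, \rank U <= \rank (\sum_l <<U *m X l>>)%MS)%N ->
  exists T : L -> 'M[K]_N, blowup T X \in unitmx.
Proof.
move=> noshrunk.
pose P s d := exists T : L -> 'M[K]_d, (s * d <= \rank (blowup T X))%N.
have [[T hT]|nP] := classic (P N N).
  by exists T; rewrite -row_free_unit /row_free eqn_leq rank_leq_row.
have down s e : (s <= N)%N -> P s (N + e)%N -> P s N.
  move=> sN; elim: e => [|e IH]; first by rewrite addn0.
  rewrite addnS => -[T hT]; apply: IH.
  by apply: (blowup_rank_reduction hK _ hT); rewrite (leq_trans sN) ?leq_addr.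
have [r [rN [T hT] nPr]] : exists r, [/\ (r < N)%N, P r N & ~ P r.+1 N].
  apply: NNPP => h; suff : forall s, (s <= N)%N -> P s N by move/(_ N (leqnn N)).
  elim=> [|s IH] sN; first by exists (fun=> 0); rewrite mul0n.
  by apply: NNPP => nPs; apply: h; exists s; split=> //; apply/IH/ltnW.
(* Rank above [r * e] would round up to [r.+1 * e] by regularity and descend to size [N], against
   the choice of [r]. *)
have max_rank e (S : L -> 'M[K]_e) : (N <= e)%N -> (\rank (blowup S X) <= r * e)%N.
  move=> Ne; rewrite leqNgt; apply/negP => /(blowup_rank_divisible hK) h.
  by apply: nPr; apply: (down _ (e - N)%N rN); rewrite subnKC.
have rankT : \rank (blowup T X) = (r * N)%N.
  by apply/eqP; rewrite eqn_leq hT max_rank.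
have [|U] := wong_shrunk rankT max_rank rN; first exact: leq_ltn_trans rN.
by rewrite ltnNge noshrunk.
Qed.

(** * Extremal rays *)

Definition dot (R : pzSemiRingType) n (u v : 'rV[R]_n) : R := \sum_i u 0 i * v 0 i.

Lemma dotDl (R : pzRingType) n (u v w : 'rV[R]_n) : dot (u + v) w = dot u w + dot v w.
Proof. by rewrite -big_split; apply: eq_bigr => i _; rewrite mxE mulrDl. Qed.

Lemma dotZl (R : pzRingType) n a (u v : 'rV[R]_n) : dot (a *: u) v = a * dot u v.
Proof. by rewrite /dot mulr_sumr; apply: eq_bigr => i _; rewrite mxE mulrA. Qed.

Lemma seq_argmin (T : eqType) (R : realDomainType) (P : pred T) (f : T -> R) (s : seq T) :
  has P s -> exists x, [/\ x \in s, P x & forall y, y \in s -> P y -> f x <= f y].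
Proof.
elim: s => //= a s IH; have [/IH[x [xs Px xm]] _|nP] := boolP (has P s); last first.
  rewrite orbF => Pa; exists a; rewrite mem_head; split=> // y.
  by rewrite inE => /predU1P[-> //|ys Py]; case/negP: nP; apply/hasP; exists y.
have [/andP[Pa lt_ax]|h] := boolP (P a && (f a < f x)).
  exists a; rewrite mem_head; split=> // y; rewrite inE => /predU1P[-> //|ys Py].
  exact: le_trans (ltW lt_ax) (xm _ ys Py).
exists x; rewrite inE xs orbT; split=> // y; rewrite inE => /predU1P[->|]; last exact: xm.
by move=> Pa; move: h; rewrite Pa /= -leNgt.
Qed.

Lemma count_lt (T : eqType) (a b : pred T) (s : seq T) x :
  {in s, forall y, a y -> b y} -> x \in s -> b x -> ~~ a x -> (count a s < count b s)%N.
Proof.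
elim: s => // y s IH ab; rewrite inE => xys bx nax /=.
have abs : {in s, forall z, a z -> b z} by move=> z zs; apply: ab; rewrite inE zs orbT.
have le_ab : (count a s <= count b s)%N.
  have -> : count a s = count (fun z => a z && b z) s.
    by apply: eq_in_count => z zs /=; case az: (a z) => //=; rewrite abs.
  by apply: sub_count => z /andP[].
case/predU1P: xys => [<-|xs]; first by rewrite bx (negPf nax); lia.
have := IH abs xs bx nax.
have := ab y (mem_head _ _); case: (a y) (b y) => [] [] //= h; lia.
Qed.

(** If a direction [t] respects the tight constraints without being a multiple of the weight, moving
    along it makes one more constraint tight. As [S] separates vectors, [t] or its opposite is
    positive on some constraint, so the move stops. *)
Lemma extremal_ray n (S : seq 'rV[rat]_n) (sigma0 : 'rV[rat]_n) :
  (forall tau, {in S, forall b, dot tau b = 0} -> tau = 0) ->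
  sigma0 != 0 -> {in S, forall b, dot sigma0 b <= 0} ->
  exists sigma : 'rV[rat]_n, [/\ sigma != 0, {in S, forall b, dot sigma b <= 0} &
    forall tau, {in S, forall b, dot sigma b = 0 -> dot tau b = 0} ->
      exists q, tau = q *: sigma].
Proof.
move=> span; pose tight (s : 'rV[rat]_n) := count (fun b => dot s b == 0) S.
move: {2}(size S - tight sigma0)%N (leqnn (size S - tight sigma0)) => k.
elim: k sigma0 => [|k IH] s hk s0 sS.
  exists s; split=> // tau h; exists 0; rewrite scale0r; apply: span => b bS.
  apply: h => //; apply/eqP; move: b bS; apply/allP; rewrite all_count.
  by rewrite eqn_leq count_size -subn_eq0 -leqn0.
have [h|] := classic (forall tau, {in S, forall b, dot s b = 0 -> dot tau b = 0} ->
      exists q, tau = q *: s); first by exists s.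
move=> /not_all_ex_not[t1 ht1]; have [t1S nt1] := imply_to_and _ _ ht1.
have [t [tS tn [b0 b0S tb0]]] : exists t, [/\ {in S, forall b, dot s b = 0 -> dot t b = 0},
    ~ (exists q, t = q *: s) & exists2 b, b \in S & 0 < dot t b].
  have [b bS tb] : exists2 b, b \in S & dot t1 b != 0.
    apply: NNPP => h; apply: nt1; exists 0; rewrite scale0r; apply: span => b bS.
    by apply/eqP/negPn/negP => nb; apply: h; exists b.
  have [lt|lt|e] := ltgtP 0 (dot t1 b); last by rewrite -e eqxx in tb.
    by exists t1; split=> //; exists b.
  exists (- t1); split.
  - by move=> c cS sc; rewrite -scaleN1r dotZl t1S // mulr0.
  - case=> q e; apply: nt1; exists (- q); rewrite scaleNr -e opprK //.
  - by exists b => //; rewrite -scaleN1r dotZl mulN1r oppr_gt0.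
have hasb : has (fun b => 0 < dot t b) S by apply/hasP; exists b0.
have [b [bS tb bmin]] := seq_argmin (fun b => - dot s b / dot t b) hasb.
(* The longest step along [t] that violates no inequality; the minimising [b] becomes tight. *)
pose lam := - dot s b / dot t b.
have sb : dot s b < 0.
  rewrite lt_neqAle sS // andbT; apply: contraTneq tb => /(tS b bS) ->.
  by rewrite ltxx.
have lam0 : 0 < lam by rewrite divr_gt0 // oppr_gt0.
have dotE c : dot (s + lam *: t) c = dot s c + lam * dot t c by rewrite dotDl dotZl.
apply: (IH (s + lam *: t)).
- suff : (tight s < tight (s + lam *: t)%R)%N.
    by move: hk; have := count_size (fun b => dot s b == 0) S; rewrite -/(tight s); lia.
  apply: (count_lt (x := b)) => //.
  + by move=> c cS /eqP sc; rewrite dotE sc tS // mulr0 addr0.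
  + by rewrite dotE /lam (divfK (lt0r_neq0 tb)) subrr.
  + by rewrite lt_eqF.
- apply: contra_notN tn => /eqP e; exists (- lam^-1).
  have -> : s = - (lam *: t) by apply/eqP; rewrite -addr_eq0 e.
  by rewrite scaleNr scalerN opprK scalerA mulVf ?scale1r // gt_eqF.
- move=> c cS; rewrite dotE; have [tc|tc] := ltP 0 (dot t c).
    by have := bmin c cS tc; rewrite -/lam ler_pdivlMr // => h; rewrite addrC -lerBrDr sub0r.
  by rewrite -[0]addr0 lerD ?sS // pmulr_rle0.
Qed.

(** Expanding the product of row sums gives one term per map on the indices; the terms of the
    permutations already bound the determinant. *)
Lemma det_le_prod_row_sums n (M : 'M[int]_n) : `|\det M| <= \prod_i \sum_j `|M i j|.
Proof.
rewrite bigA_distr_bigA /=; apply: le_trans (ler_norm_sum _ _ _) _.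
have -> : \sum_(s : 'S_n) `|(-1) ^+ s * \prod_i M i (s i)| =
    \sum_(s : 'S_n) \prod_i `|M i (pval s i)|.
  apply: eq_bigr => s _; rewrite normrM normrX normrN1 expr1n mul1r normr_prod.
  by apply: eq_bigr => i _; rewrite pvalE.
rewrite [leRHS](bigID (fun g : {ffun 'I_n -> 'I_n} => injectiveb g)) /=.
rewrite [X in _ <= X + _](reindex (fun s : 'S_n => pval s)) /=; last first.
  by exists (insubd (1%g : 'S_n)) => g Ug; first apply: val_inj; apply: insubdK.
rewrite [X in _ <= X + _](eq_bigl predT); last by case.
by rewrite lerDl sumr_ge0 // => g _; rewrite prodr_ge0.
Qed.

Lemma ler_sum_inj (R : numDomainType) (I J : finType) (h : I -> J) (F : J -> R) :
  injective h -> (forall j, 0 <= F j) -> \sum_i F (h i) <= \sum_j F j.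
Proof.
move=> h_inj F0; rewrite -(big_imset F (A := predT) (in2W h_inj)) /=.
by rewrite [leRHS](bigID (mem (h @: predT))) /= lerDl sumr_ge0.
Qed.

Section CofactorRay.
Variables (k n : nat) (G : 'M[int]_(k, n.+1)) (sigma : 'rV[rat]_n.+1).
Hypothesis G_ge0 : forall i j, 0 <= G i j.
Hypothesis sigma_neq0 : sigma != 0.
Local Notation ratm M := (map_mx (intr : int -> rat) M).
Hypothesis G_sigma : ratm G *m sigma^T = 0.
Hypothesis G_perp : forall tau : 'rV[rat]_n.+1, ratm G *m tau^T = 0 ->
  exists q, tau = q *: sigma.
Let a j := \sum_i G i j.

Lemma cofactor_ray : exists (c : 'rV[int]_n.+1) (q : rat),
  [/\ 0 < q, ratm c = q *: sigma &
     (\sum_x `|c 0 x| * a x) * (n%:Z ^+ n) <= (\sum_x a x) ^+ n.+1].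
Proof.
have rankG : \rank (ratm G) = n.
  have : \rank (kermx (ratm G)^T) = 1.
    have -> : \rank (kermx (ratm G)^T) = \rank sigma.
      apply/eqmx_rank/andP; split.
        apply/row_subP => i; have [|q ->] := @G_perp (row i (kermx (ratm G)^T)).
          by rewrite -[_ *m _]trmxK trmx_mul trmxK -row_mul mulmx_ker row0 trmx0.
        exact: scalemx_sub.
      by apply/sub_kermxP; rewrite -[_ *m _]trmxK trmx_mul trmxK G_sigma trmx0.
    by rewrite rank_rV sigma_neq0.
  rewrite mxrank_ker mxrank_tr; have := rank_leq_col (ratm G); lia.
have [f [f_inj f_free]] : exists f : 'I_n -> 'I_k,
    injective f /\ row_free (rowsub f (ratm G)).
  move: (maxrankfun (ratm G)) (@maxrankfun_inj _ _ _ (ratm G)) (maxrowsub_free (ratm G)).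
  by rewrite rankG => f; exists f.
pose H := rowsub f G.
have HG : (ratm G <= ratm H)%MS.
  rewrite /H map_mxsub; have := rowsub_sub f (ratm G).
  by move/mxrank_leqif_sup/eq_leqif <-; rewrite rankG.
pose M (R : pzRingType) (r : 'rV[R]_n.+1) (H : 'M[R]_(n, n.+1)) : 'M[R]_(1 + n) := col_mx r H.
(* Prepending a row [r] to [H] makes the determinant the product of [r] with [c]: rows of [H] give
   orthogonality, and [r = sigma] will show that [c] is nonzero. *)
pose c := \row_j cofactor (M _ 0 H) 0 j.
have detM (R : comPzRingType) (h : {rmorphism int -> R}) (r : 'rV[R]_n.+1) :
    \det (M _ r (map_mx h H)) = \sum_j r 0 j * h (c 0 j).
  rewrite (expand_det_row _ 0); apply: eq_bigr => j _.
  rewrite mxE; congr (_ * _).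
    by case: splitP => // i _; rewrite ord1.
  rewrite mxE /cofactor rmorphM rmorphXn rmorphN1; congr (_ * _).
  rewrite -det_map_mx; congr (\det _); apply/matrixP => i j'; rewrite !mxE.
  case: splitP => i' e; rewrite !mxE //.
  by have := ltn_ord i'; rewrite -e.
have c_perp i : \sum_j (row i H) 0 j * c 0 j = 0.
  have := detM _ idfun (row i H); rewrite (_ : map_mx _ H = H); last first.
    by apply/matrixP => x y; rewrite !mxE.
  move=> <-; apply: (determinant_alternate (i1 := lshift n 0) (i2 := rshift 1 i)).
    by rewrite -val_eqE.
  move=> j; rewrite col_mxEu col_mxEd mxE.
  by [].
have Hc : ratm H *m (ratm c)^T = 0.
  apply/matrixP => i j; rewrite ord1 [RHS]mxE -(rmorph0 intr) -(c_perp i) mxE rmorph_sum.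
  by apply: eq_bigr => l _; rewrite !mxE rmorphM.
have [q qc] : exists q, ratm c = q *: sigma.
  apply: G_perp; case/submxP: HG => D ->.
  by rewrite -mulmxA Hc mulmx0.
(* The weight [sigma] is orthogonal to the independent rows of [H] and has positive square over the
   rationals, so together they form an invertible matrix. *)
have q0 : q != 0.
  apply/eqP => q0; have := detM _ intr sigma.
  have -> : \sum_j sigma 0 j * (c 0 j)%:~R = 0.
    rewrite big1 // => j _; have := congr1 (fun r : 'rV_n.+1 => r 0 j) qc.
    by rewrite q0 scale0r !mxE => ->; rewrite mulr0.
  have Hs : ratm H *m sigma^T = 0.
    by rewrite /H map_mxsub mul_rowsub_mx G_sigma; apply/matrixP => i j; rewrite !mxE.
  apply/eqP; rewrite -unitfE -[_ \is a _]/(_ \in unitmx) -row_free_unit.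
  apply/inj_row_free => v; rewrite -[v]hsubmxK mul_row_col => e.
  have s1 : sigma *m sigma^T = (\sum_j sigma 0 j ^+ 2)%:M.
    by rewrite [LHS]mx11_scalar mxE; congr (_%:M); apply: eq_bigr => j _; rewrite mxE.
  have s0 : \sum_j sigma 0 j ^+ 2 != 0.
    apply: contra sigma_neq0; rewrite psumr_eq0 => [/allP h|j _]; last exact: sqr_ge0.
    apply/eqP/rowP => j; rewrite mxE; apply/eqP; rewrite -sqrf_eq0.
    by apply: h; rewrite mem_index_enum.
  have l0 : lsubmx v = 0.
    have := congr1 (fun r => r *m sigma^T) e; rewrite mulmxDl mul0mx.
    rewrite -[rsubmx v *m _ *m _]mulmxA Hs mulmx0 addr0 -mulmxA s1 mul_mx_scalar.
    by move/eqP; rewrite scaler_eq0 (negPf s0) => /eqP.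
  move: e; rewrite l0 mul0mx add0r => e.
  have -> : rsubmx v = 0.
    by apply: (row_free_inj (A := ratm H)); rewrite ?e ?mul0mx // /H map_mxsub.
  by rewrite row_mx0.
have bound : (\sum_x `|c 0 x| * a x) * (n%:Z ^+ n) <= (\sum_x a x) ^+ n.+1.
  pose rho i := \sum_j G i j.
  have rho0 i : 0 <= rho i by apply: sumr_ge0 => j _.
  have a0 j : 0 <= a j by apply: sumr_ge0 => i _.
  have cle x : `|c 0 x| <= \prod_i rho (f i).
    rewrite mxE normrM normrX normrN1 expr1n mul1r.
    apply: le_trans (det_le_prod_row_sums _) _; apply: ler_prod => i _.
    rewrite sumr_ge0 //=; apply: le_trans (ler_sum_inj (@lift_inj _ x) (G_ge0 (f i))).
    apply: ler_sum => j _; rewrite !mxE; case: splitP => i' e.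
      by have := ltn_ord i'; rewrite -e.
    rewrite mxE ger0_norm //; have -> // : i = i' by apply/ord_inj; case: e.
  (* The chosen rows are distinct, so their sums add up to at most the total of [G]. *)
  have prodle : (\prod_i rho (f i)) * n%:Z ^+ n <= (\sum_x a x) ^+ n.
    have cardT : #|(predT : pred 'I_n)| = n by rewrite card_ord.
    have AGM : \prod_i (rho (f i) *+ n) <= (\sum_i rho (f i)) ^+ n.
      have := @leif_AGM_scaled _ 'I_n predT (fun i => rho (f i)); rewrite cardT.
      by move=> h; case: h => // i _; rewrite mulrn_wge0.
    rewrite prodrMn prod_nat_const cardT -mulr_natr natrX natz in AGM.
    apply: le_trans AGM _.
    rewrite lerXn2r ?nnegrE ?sumr_ge0 //.
    rewrite [leRHS]exchange_big /=; exact: (ler_sum_inj f_inj rho0).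
  rewrite exprSr.
  apply: (@le_trans _ _ ((\prod_i rho (f i)) * (\sum_x a x) * n%:Z ^+ n)).
    rewrite ler_wpM2r ?exprn_ge0 // mulr_sumr ler_sum // => x _.
    by rewrite ler_wpM2r.
  by rewrite mulrAC ler_wpM2r ?sumr_ge0.
have [q_lt|q_gt|e] := ltgtP q 0; last by rewrite e eqxx in q0.
  exists (- c), (- q); split; first by rewrite oppr_gt0.
    by rewrite map_mxN qc scaleNr.
  by under eq_bigr => x _ do rewrite mxE normrN.
by exists c, q.
Qed.
End CofactorRay.

(** * Subrepresentations *)

Section Height.
Variables (Q : quiver) (hQ : no_oriented_cycles Q).

Definition arrow_rel : rel (vertex Q) :=
  [rel x y | [exists a, (ta a == x) && (ha a == y)]].

(** Counting predecessors gives a grading that strictly increases along arrows, without choosing a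
    topological order. *)
Definition height (y : vertex Q) : nat := #|[pred x | connect arrow_rel x y]|.

Lemma arrow_path (y : vertex Q) p (a : arrow Q) : ha a = y -> path arrow_rel y p ->
  exists2 q, path [rel a b | ha a == ta b] a q & ha (last a q) = last y p.
Proof.
elim: p y a => [|z p IH] y a ay /=; first by exists [::].
case/andP => /existsP[b /andP[/eqP tb /eqP hb]] /(IH _ b hb)[q qp ql].
by exists (b :: q) => //=; rewrite ay tb eqxx.
Qed.

Lemma height_lt (a : arrow Q) : (height (ta a) < height (ha a))%N.
Proof.
have ea : arrow_rel (ta a) (ha a) by apply/existsP; exists a; rewrite !eqxx.
apply: proper_card; apply/properP; split.
  by apply/subsetP => x; rewrite !inE => h; apply: connect_trans h (connect1 ea).
exists (ha a); rewrite !inE //; apply/negP => /connectP[p /(arrow_path (erefl _))[q qp ql] e].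
by have := hQ (p := a :: q); rewrite /= rcons_path qp /= ql -e eqxx => /(_ isT).
Qed.

Lemma height_le (x : vertex Q) : (height x <= #|vertex Q|)%N.
Proof. exact: max_card. Qed.

End Height.

Section Subrepresentations.
Variables (K : fieldType) (Q : quiver) (alpha : dimvec Q) (V : Rep K alpha).

Definition subspaces := forall x : vertex Q, 'M[K]_(alpha x).

(** Subspaces are row spaces while [V a] acts on columns, hence the transpose. *)
Definition subrep (W : subspaces) : Prop :=
  forall a, (W (ta a) *m (V a)^T <= W (ha a))%MS.

Definition dims (W : subspaces) : dimvec Q := [ffun x => \rank (W x)].

Definition pairing (tau : vertex Q -> rat) (b : dimvec Q) : rat :=
  \sum_x tau x * (b x)%:R.

(** The vertices higher than [x], with or without [x] itself, carry two subrepresentations whose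
    dimension vectors differ only by [alpha x] at [x]. *)
Lemma subrep_span (hQ : no_oriented_cycles Q) (halpha : sincere alpha)
    (tau : vertex Q -> rat) :
  (forall W, subrep W -> pairing tau (dims W) = 0) -> forall x, tau x = 0.
Proof.
move=> h x.
pose U (b : bool) : subspaces := fun y =>
  if (height x < height y)%N || b && (y == x) then 1%:M else 0.
have subU b : subrep (U b).
  move=> a; rewrite /U; case: ifP => ta_in; last by rewrite mul0mx sub0mx.
  suff -> : (height x < height (ha a))%N by rewrite submx1.
  apply: leq_ltn_trans (height_lt hQ a).
  by case/orP: ta_in => [/ltnW //|/andP[_ /eqP ->]].
have := h _ (subU true); rewrite -[RHS](h _ (subU false)) /pairing.
rewrite (bigD1 x) //= [RHS](bigD1 x) //= => /eqP.
rewrite (eq_bigr (fun y => tau y * (dims (U false) y)%:R)) => [|y /negPf yx]; last first.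
  by rewrite !ffunE /U yx andbF.
rewrite (inj_eq (addIr _)) !ffunE /U ltnn /= eqxx mxrank1 mxrank0 mulr0.
by rewrite mulf_eq0 pnatr_eq0 -leqn0 leqNgt halpha orbF => /eqP.
Qed.

Variable sigma : vertex Q -> rat.
Hypothesis semistable : forall W, subrep W -> pairing sigma (dims W) <= 0.

Definition tight (W : subspaces) := subrep W /\ pairing sigma (dims W) = 0.
Definition total (W : subspaces) := (\sum_x \rank (W x))%N.

Lemma pairing_modular tau (W W' : subspaces) :
  pairing tau (dims (fun x => W x + W' x)%MS) + pairing tau (dims (fun x => W x :&: W' x)%MS)
  = pairing tau (dims W) + pairing tau (dims W').
Proof.
rewrite -!big_split; apply: eq_bigr => x _ /=.
by rewrite !ffunE -!mulrDr -!natrD mxrank_sum_cap.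
Qed.

(** Semistability bounds both values by 0, while modularity makes their sum 0. *)
Lemma tight_modular W W' : tight W -> tight W' ->
  tight (fun x => W x + W' x)%MS /\ tight (fun x => W x :&: W' x)%MS.
Proof.
move=> [sW tW] [sW' tW'].
have sD : subrep (fun x => W x + W' x)%MS.
  by move=> a; rewrite addsmxMr addsmxS.
have sI : subrep (fun x => W x :&: W' x)%MS.
  move=> a; rewrite sub_capmx.
  by rewrite (submx_trans (submxMr _ (capmxSl _ _))) ?(submx_trans (submxMr _ (capmxSr _ _))).
have := pairing_modular sigma W W'; rewrite tW tW' addr0.
have := semistable sD; have := semistable sI.
by move=> h1 h2 h3; split; split=> //; lra.
Qed.

(* Dimension vectors of the factors of a Jordan-Hoelder filtration of [W] in the
   modular lattice of tight subrepresentations. *)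
Lemma tight_factors (W : subspaces) : tight W ->
  exists gs : seq (dimvec Q),
    [/\ forall x, (\sum_(g <- gs) g x)%N = \rank (W x),
        forall g, g \in gs -> pairing sigma g = 0 &
        forall tau, (forall g, g \in gs -> pairing tau g = 0) ->
          forall W', tight W' -> (forall x, W' x <= W x)%MS -> pairing tau (dims W') = 0].
Proof.
have [m] := ubnP (total W); elim: m W => // m IH W /ltnSE le_m tW.
have tight0 : tight (fun x => 0).
  split; first by move=> a; rewrite mul0mx sub0mx.
  by rewrite /pairing big1 // => x _; rewrite ffunE mxrank0 mulr0.
have [W0|Wpos] := posnP (total W).
  have rk0 x : \rank (W x) = 0%N.
    by move/eqP: W0; rewrite /total sum_nat_eq0 => /forallP/(_ x)/eqP.
  exists [::]; split=> // [x|tau _ W' _ le]; first by rewrite big_nil rk0.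
  rewrite /pairing big1 // => x _; rewrite ffunE.
  by have := mxrankS (le x); rewrite rk0 leqn0 => /eqP ->; rewrite mulr0.
pose P k := exists W1, [/\ tight W1, forall x, (W1 x <= W x)%MS & total W1 = k].
have [W1 [tW1 le1 lt1 max1]] : exists W1, [/\ tight W1, forall x, (W1 x <= W x)%MS,
    (total W1 < total W)%N & forall W2, tight W2 -> (forall x, W2 x <= W x)%MS ->
      (total W2 < total W)%N -> (total W2 <= total W1)%N].
  pose p k := if excluded_middle_informative (P k) then (k < total W)%N else false.
  have pP k : reflect (P k /\ (k < total W)%N) (p k).
    by rewrite /p; case: excluded_middle_informative => h; apply: (iffP idP) => // -[].
  have ex0 : exists k, p k.
    exists 0%N; apply/pP; split=> //; exists (fun=> 0); split=> //.
      by move=> x; apply: sub0mx.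
    by rewrite /total big1 // => x _; rewrite mxrank0.
  have ub k : p k -> (k <= total W)%N by case/pP => _ /ltnW.
  case: (ex_maxnP ex0 ub) => k /pP[[W1 [t1 l1 e1]] ltk] km.
  exists W1; split; rewrite ?e1 // => W2 t2 l2 lt2; apply: km; apply/pP; split=> //.
  by exists W2.
have [gs [sum_g sg span_g]] := IH W1 (leq_trans lt1 le_m) tW1.
pose g : dimvec Q := [ffun x => (\rank (W x) - \rank (W1 x))%N].
have pg tau : pairing tau g = pairing tau (dims W) - pairing tau (dims W1).
  rewrite -sumrB; apply: eq_bigr => x _.
  by rewrite !ffunE natrB ?mxrankS // mulrBr.
exists (g :: gs); split.
- by move=> x; rewrite big_cons sum_g ffunE subnK ?mxrankS.
- move=> g'; rewrite inE => /predU1P[->|/sg //].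
  by rewrite pg tW.2 tW1.2 subrr.
move=> tau htau W' tW' le'.
have htau_gs g' : g' \in gs -> pairing tau g' = 0.
  by move=> g'in; rewrite htau // inE g'in orbT.
(* By maximality of [W1], either [W'] lies in [W1], or the two sum to [W]. In the second case
   modularity reduces [W'] to its intersection with [W1] and to the new factor [g]. *)
have [tD tI] := tight_modular tW' tW1.
have leD x : (W' x + W1 x <= W x)%MS by rewrite addsmx_sub le' le1.
have [lt|ge] := ltnP (total (fun x => W' x + W1 x)%MS) (total W).
  have := max1 _ tD leD lt => tot_le.
  apply: (span_g _ htau_gs) => // x.
  have eq_rank : \rank (W1 x) == \rank (W' x + W1 x)%MS.
    rewrite eqn_leq mxrankS ?addsmxSr //=.
    rewrite -(leq_add2r (\sum_(y | y != x) \rank (W1 y))%N).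
    move: tot_le; rewrite /total (bigD1 x) //= [leqRHS](bigD1 x) //=.
    apply: leq_trans; rewrite leq_add2l; apply: leq_sum => y _.
    by rewrite mxrankS ?addsmxSr.
  apply: submx_trans (addsmxSl _ (W1 x)) _.
  by rewrite -(mxrank_leqif_sup (addsmxSr _ _)).2.
have := pairing_modular tau W' W1.
have -> : pairing tau (dims (fun x => W' x + W1 x)%MS) = pairing tau (dims W).
  apply: eq_bigr => x _; rewrite !ffunE; congr (_ * _%:R); apply/eqP.
  rewrite eqn_leq mxrankS //= -(leq_add2r (\sum_(y | y != x) \rank (W' y + W1 y)%MS)%N).
  move: ge; rewrite /total (bigD1 x) //= [leqRHS](bigD1 x) //=.
  apply: leq_trans; rewrite leq_add2l; apply: leq_sum => y _.
  by rewrite mxrankS.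
rewrite (span_g _ htau_gs _ tI) => [|x]; last exact: capmxSr.
have := htau g (mem_head _ _); rewrite pg.
by lra.
Qed.

End Subrepresentations.

(** * Semistability weights of bounded size *)

Section BoundedWeight.
Variables (K : fieldType) (Q : quiver) (hQ : no_oriented_cycles Q).
Variables (alpha : dimvec Q) (halpha : sincere alpha) (V : Rep K alpha).

Definition semistable_weight (sigma : weight Q) : Prop :=
  wdot sigma alpha = 0 /\ forall W, subrep V W -> wdot sigma (dims W) <= 0.

Lemma wdot_pairing (sigma : weight Q) (b : dimvec Q) :
  (wdot sigma b)%:~R = pairing (fun x => (sigma x)%:~R) b.
Proof. by rewrite rmorph_sum; apply: eq_bigr => x _; rewrite rmorphM. Qed.

Lemma dims_full : dims (fun x => 1%:M : 'M[K]_(alpha x)) = alpha.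
Proof. by apply/ffunP => x; rewrite ffunE mxrank1. Qed.

Lemma subrep_full : subrep V (fun x => 1%:M).
Proof. by move=> a; rewrite submx1. Qed.

(** The positive and negative parts have equal size because [wdot sigma alpha = 0]; this factor 2
    becomes, after squaring, the 4 of the theorem. *)
Lemma wsize_norm (sigma : weight Q) : wdot sigma alpha = 0 ->
  2%:R * wsize sigma alpha = \sum_x `|sigma x| * (alpha x)%:Z.
Proof.
move=> s0; transitivity (2%:R * wsize sigma alpha - wdot sigma alpha).
  by rewrite s0 subr0.
rewrite /wsize /wdot mulr_sumr -sumrB.
apply: eq_bigr => x _; rewrite ffunE mulrA -mulrBl; congr (_ * _).
by case: (lerP (sigma x) 0) => h; [rewrite ler0_norm | rewrite gtr0_norm]; lia.
Qed.

(** Only finitely many dimension vectors occur, which makes the cone of weights polyhedral; a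
    classical test selects them. *)
Definition subdims : seq (dimvec Q) :=
  [seq b <- [seq ([ffun x => val (b x)] : dimvec Q) |
               b : {ffun vertex Q -> 'I_(norm1 alpha).+1}] |
     if excluded_middle_informative (exists2 W, subrep V W & dims W = b)
     then true else false].

Lemma subdimsP b : b \in subdims <-> exists2 W, subrep V W & dims W = b.
Proof.
rewrite mem_filter; split; first by case: excluded_middle_informative.
move=> h; rewrite (_ : (if _ then _ else _) = true) /=; last first.
  by case: excluded_middle_informative.
case: h => W _ <-; have le x : (\rank (W x) < (norm1 alpha).+1)%N.
  rewrite ltnS (leq_trans (rank_leq_row _)) // /norm1 (bigD1 x) //=.
  exact: leq_addr.
apply/imageP; exists [ffun x => Ordinal (le x)] => //.
by apply/ffunP => x; rewrite !ffunE.
Qed.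

Lemma bounded_semistable_weight (sigma0 : weight Q) :
  sigma0 != 0 -> semistable_weight sigma0 ->
  exists sigma : weight Q, [/\ sigma != 0, semistable_weight sigma &
    2%:R * wsize sigma alpha * (#|vertex Q|.-1)%:Z ^+ #|vertex Q|.-1 <=
      (norm1 alpha)%:Z ^+ #|vertex Q|].
Proof.
move=> s00 [s0a s0W].
have [x0 sx0] : exists x, sigma0 x != 0.
  apply/existsP; apply: contraNT s00; rewrite negb_exists => /forallP h.
  by apply/eqP/ffunP => x; rewrite ffunE; apply/eqP; have := h x; rewrite negbK.
have [n en] : exists n, #|vertex Q| = n.+1.
  by exists #|vertex Q|.-1; rewrite prednK //; apply/card_gt0P; exists x0.
rewrite en /=.
pose v (i : 'I_n.+1) : vertex Q := enum_val (cast_ord (esym en) i).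
pose w (x : vertex Q) : 'I_n.+1 := cast_ord en (enum_rank x).
have vK : cancel v w by move=> i; rewrite /v /w enum_valK cast_ordKV.
have wK : cancel w v by move=> x; rewrite /v /w cast_ordK enum_rankK.
have vsum (R : nmodType) (F : vertex Q -> R) : \sum_i F (v i) = \sum_x F x.
  by rewrite (reindex v) //; exists w => x _.
pose rowv (f : vertex Q -> rat) : 'rV[rat]_n.+1 := \row_i f (v i).
pose colv (r : 'rV[rat]_n.+1) (x : vertex Q) := r 0 (w x).
pose dv (b : dimvec Q) := rowv (fun x => (b x)%:R).
have dotv (r : 'rV[rat]_n.+1) b : dot r (dv b) = pairing (colv r) b.
  by rewrite /pairing -vsum; apply: eq_bigr => i _; rewrite mxE /colv vK.
have dotvN (r : 'rV[rat]_n.+1) b : dot r (- dv b) = - pairing (colv r) b.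
  by rewrite -dotv -sumrN; apply: eq_bigr => i _; rewrite mxE mulrN.
(* The full representation gives [sigma . alpha <= 0]; the extra constraint [- dv alpha] turns this
   into an equality. *)
pose S := - dv alpha :: [seq dv b | b <- subdims].
have SP (P : 'rV[rat]_n.+1 -> Prop) : P (- dv alpha) ->
    (forall W, subrep V W -> P (dv (dims W))) -> {in S, forall b, P b}.
  move=> Pa PW b; rewrite inE => /predU1P[-> //|/mapP[b' /subdimsP[W sW <-] ->]].
  exact: PW.
have Sa : - dv alpha \in S by rewrite mem_head.
have SW W : subrep V W -> dv (dims W) \in S.
  by move=> sW; rewrite inE map_f ?orbT //; apply/subdimsP; exists W.
have [|||s [s_neq0 sS s_ray]] := @extremal_ray _ S (rowv (fun x => (sigma0 x)%:~R)).
- move=> tau h; apply/rowP => i; rewrite mxE -[i]vK.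
  apply: (@subrep_span _ _ _ V hQ halpha (colv tau)) => W sW.
  by rewrite -dotv h // SW.
- apply: contra sx0 => /eqP/rowP/(_ (w x0)); rewrite !mxE wK => /eqP.
  by rewrite intr_eq0.
- have e b : pairing (colv (rowv (fun x => (sigma0 x)%:~R))) b = (wdot sigma0 b)%:~R.
    by rewrite wdot_pairing; apply: eq_bigr => x _; rewrite /colv mxE wK.
  apply: SP => [|W sW]; first by rewrite dotvN e s0a oppr0.
  by rewrite dotv e lerz0 s0W.
have semi W : subrep V W -> pairing (colv s) (dims W) <= 0.
  by move=> sW; rewrite -dotv sS // SW.
have sa : pairing (colv s) alpha = 0.
  apply/eqP; rewrite eq_le -{1}dims_full (semi _ subrep_full) /=.
  by rewrite -oppr_le0 -dotvN sS.
have tfull : tight V (colv s) (fun=> 1%:M).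
  by split; [apply: subrep_full | rewrite dims_full].
have [gs [gs_sum gs_perp gs_span]] := tight_factors semi tfull.
pose G : 'M[int]_(size gs, n.+1) := \matrix_(i, j) (tnth (in_tuple gs) i (v j))%:Z.
have GE (r : 'rV[rat]_n.+1) i : (map_mx intr G *m r^T) i 0 =
    pairing (colv r) (tnth (in_tuple gs) i).
  rewrite mxE /pairing -vsum; apply: eq_bigr => j _.
  by rewrite !mxE /colv vK mulrC.
have [||||c [q [q0 cq bound]]] := @cofactor_ray _ _ G s.
- by move=> i j; rewrite mxE.
- exact: s_neq0.
- by apply/colP => i; rewrite GE mxE gs_perp // mem_tnth.
- move=> tau htau; apply: s_ray.
  have tau_gs g : g \in gs -> pairing (colv tau) g = 0.
    by case/(tnthP (in_tuple gs)) => i ->; rewrite -GE htau mxE.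
  (* Vanishing on the factors forces vanishing on all tight subrepresentations, thus on all
     constraints tight along the ray. *)
  have tau_tight := gs_span _ tau_gs.
  apply: SP => [|W sW].
    rewrite !dotvN sa => _; rewrite -dims_full tau_tight ?oppr0 //.
  by rewrite !dotv => sW0; rewrite tau_tight // => x; rewrite submx1.
(* The factors fill the full representation, so the column sums of [G] are the entries of
   [alpha]. *)
have ca : forall j, \sum_i G i j = (alpha (v j))%:Z.
  move=> j; rewrite -[alpha _](mxrank1 K) -gs_sum big_tnth -natz natr_sum.
  by apply: eq_bigr => i _; rewrite mxE natz.
have cs j : (c 0 j)%:~R = q * s 0 j :> rat.
  by have := congr1 (fun r : 'rV[rat]_n.+1 => r 0 j) cq; rewrite !mxE.
pose sigma : weight Q := [ffun x => c 0 (w x)].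
have sE b : (wdot sigma b)%:~R = q * pairing (colv s) b.
  rewrite wdot_pairing mulr_sumr; apply: eq_bigr => x _.
  by rewrite ffunE cs mulrA.
have wa : wdot sigma alpha = 0.
  by apply/eqP; rewrite -(intr_eq0 rat) sE sa mulr0.
exists sigma; split.
- apply: contra s_neq0 => /eqP e; apply/eqP/rowP => j; rewrite mxE.
  have := cs j; have -> : c 0 j = sigma (v j) by rewrite ffunE vK.
  rewrite e ffunE => /esym/eqP; rewrite mulf_eq0 gt_eqF //= => /eqP.
  by [].
- split=> // W sW; rewrite -(lerz0 rat) sE pmulr_rle0 //; exact: semi.
move: bound; under eq_bigr => x _ do rewrite ca.
under [X in _ <= X ^+ _ -> _]eq_bigr => x _ do rewrite ca.
rewrite wsize_norm //.
have -> : \sum_x `|sigma x| * (alpha x)%:Z = \sum_j `|c 0 j| * (alpha (v j))%:Z.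
  by rewrite -vsum; apply: eq_bigr => j _; rewrite ffunE vK.
have -> // : (norm1 alpha)%:Z = \sum_i (alpha (v i))%:Z.
rewrite (vsum _ (fun x => (alpha x)%:Z)) /norm1 -[LHS]natz natr_sum.
by apply: eq_bigr => x _; rewrite natz.
Qed.

End BoundedWeight.

(** * Semi-invariants and one-parameter subgroups *)

Section Action.
Variables (K : fieldType) (Q : quiver) (alpha : dimvec Q).
Implicit Types (V : Rep K alpha) (A B : matfam K alpha) (f : polyRep K alpha).

Lemma peval_ext f V V' : (forall a, V a = V' a) -> peval f V = peval f V'.
Proof. by move=> e; apply: meval_eq => i; rewrite /rep_coord e. Qed.

Lemma invmxM n (A B : 'M[K]_n) : A \in unitmx -> B \in unitmx ->
  invmx (A *m B) = invmx B *m invmx A.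
Proof.
move=> uA uB; have uAB : A *m B \in unitmx by rewrite unitmx_mul uA.
by rewrite -[RHS](mulmxK uAB) mulmxA mulmxKV // mulVmx // mul1mx.
Qed.

Lemma act_comp A B V a : in_GL A -> in_GL B ->
  act A (act B V) a = act (fun x => A x *m B x) V a.
Proof. by move=> uA uB; rewrite /act invmxM // !mulmxA. Qed.

Lemma peval_act A f V : peval f (act A V) = pact (matfam_inv A) f V.
Proof. by apply: peval_ext => a; rewrite /act /matfam_inv !invmxK. Qed.

Lemma in_GL_inv A : in_GL A -> in_GL (matfam_inv A).
Proof. by move=> h x; rewrite unitmx_inv. Qed.

Lemma in_SL_GL A : in_SL A -> in_GL A.
Proof. by move=> h x; rewrite unitmxE h unitr1. Qed.

Lemma meval_horner n (f : {mpoly K[n]}) (P : 'I_n -> {poly K}) :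
  exists p : {poly K}, forall s, f.@[fun i => (P i).[s]] = p.[s].
Proof.
exists (\sum_(m <- msupp f) f@_m *: \prod_i P i ^+ m i) => s.
rewrite mevalE horner_sum; apply: eq_bigr => m _; rewrite hornerZ horner_prod.
by congr (_ * _); apply: eq_bigr => i _; rewrite horner_exp.
Qed.

Hypothesis hK : infinite_field K.

(** Along the subgroup [f] is a polynomial in [s] that equals [s ^ (- B) * peval f V] for nonzero
    [s]. Having no pole, it forces [B <= 0]; if [B = 0] it is constant, and its value at 0 is that
    at the limit representation. *)
Lemma one_parameter_weight (sigma : weight Q) f V (A : K -> matfam K alpha)
    (b : vertex Q -> int) (P : forall a, 'M[{poly K}]_(alpha (ha a), alpha (ta a))) :
  SI_weight sigma f -> peval f V != 0 ->
  (forall s x, s != 0 -> \det (A s x) = s ^ b x) ->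
  (forall s a, s != 0 -> act (A s) V a = map_mx (fun p => p.[s]) (P a)) ->
  let B := \sum_x sigma x * b x in
  B <= 0 /\ (B = 0 -> peval f (fun a => map_mx (fun p => p.[0]) (P a)) = peval f V).
Proof.
move=> sf fV detA actA B.
have [p hp] := meval_horner f
  (fun i => P (tag (enum_val i)) (tagged (enum_val i)).1 (tagged (enum_val i)).2).
have pE s : p.[s] = peval f (fun a => map_mx (fun p => p.[s]) (P a)).
  by rewrite -hp; apply: meval_eq => i; rewrite /rep_coord mxE.
have ps s : s != 0 -> p.[s] = s ^ (- B) * peval f V.
  move=> s0; rewrite pE -(peval_ext _ (fun a => actA s a s0)) peval_act sf.
    congr (_ * _); rewrite /chi /B -sumrN.
    rewrite (big_morph (fun z => s ^ z) (fun m n => expfzDr m n s0) (expr0z s)).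
    apply: eq_bigr => x _.
    by rewrite /matfam_inv det_inv detA // invr_expz exprz_exp mulNr mulrC.
  by apply: in_GL_inv => x; rewrite unitmxE detA // unitfE expfz_neq0.
split.
  rewrite leNgt; apply/negP => Bpos; have [k eB] : exists k : nat, B = k.+1.
    by exists `|B|.-1; lia.
  have : 'X^(k.+1) * p - (peval f V)%:P = 0.
    apply: (poly_eq0_nonzero hK) => s s0; rewrite !hornerE ps // eB.
    by rewrite -invr_expz mulrA divff ?expf_neq0 // mul1r subrr.
  move/(congr1 (fun p => p.[0])); rewrite !hornerE exprS !mul0r add0r => /eqP.
  by rewrite oppr_eq0 (negPf fV).
move=> B0; have : p - (peval f V)%:P = 0.
  by apply: (poly_eq0_nonzero hK) => s s0; rewrite !hornerE ps // B0 oppr0 expr0z mul1r subrr.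
by move/(congr1 (fun p => p.[0])); rewrite !hornerE pE => /eqP; rewrite subr_eq0 => /eqP.
Qed.

End Action.

Section OneParameter.
Variables (K : fieldType) (hK : infinite_field K).
Variables (Q : quiver) (alpha : dimvec Q) (V : Rep K alpha).
Variables (sigma : weight Q) (f : polyRep K alpha).
Hypothesis sf : SI_weight sigma f.
Hypothesis fV : peval f V != 0.

(** A common scalar at all vertices cancels along each arrow, so it acts trivially on [Rep]. *)
Lemma weight_wdot_ge0 : 0 <= wdot sigma alpha.
Proof.
have [s x s0|s a s0|] := one_parameter_weight hK (A := fun s x => (s^-1)%:M)
  (b := fun x => - (alpha x)%:Z) (P := fun a => map_mx polyC (V a)) sf fV.
- by rewrite det_scalar exprVn exprnN.
- rewrite /act invmx_scalar mul_scalar_mx mul_mx_scalar scalerA mulVf ?invr_neq0 // scale1r.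
  by apply/matrixP => i j; rewrite !mxE hornerC.
by under eq_bigr do rewrite mulrN; rewrite sumrN oppr_le0.
Qed.

(** Scales [W x] by [s] and fixes the complement spanned by the remaining rows of [row_ebase]; the
    transpose returns to the column convention. *)
Definition flag_torus (W : subspaces K alpha) (s : K) (x : vertex Q) : 'M[K]_(alpha x) :=
  (invmx (row_ebase (W x)) *m
   diag_mx (\row_(i < alpha x) if (i < \rank (W x))%N then s else 1) *m
   row_ebase (W x))^T.

Lemma weight_wdot_subrep W : subrep V W -> wdot sigma (dims W) <= 0.
Proof.
move=> sW; pose r x := \rank (W x); pose E x := row_ebase (W x).
have Eu x : E x \in unitmx by apply: row_ebase_unit.
have Wpid x : (W x :=: (pid_mx (r x) : 'M_(alpha x)) *m E x)%MS.
  have cu : row_full (col_ebase (W x)) by rewrite row_full_unit col_ebase_unit.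
  have := eqmxMfull ((pid_mx (r x) : 'M_(alpha x)) *m E x) cu.
  by rewrite mulmxA mulmx_ebase.
pose N a := E (ta a) *m (V a)^T *m invmx (E (ha a)).
have N0 a (i : 'I_(alpha (ta a))) (j : 'I_(alpha (ha a))) :
    (i < r (ta a))%N -> (r (ha a) <= j)%N -> N a i j = 0.
  move=> ir rj; have : (row i (E (ta a)) *m (V a)^T <= W (ha a))%MS.
    apply: submx_trans (sW a); apply: submxMr; rewrite Wpid.
    have -> : row i (E (ta a)) = row i ((pid_mx (r (ta a)) : 'M_(alpha (ta a))) *m E (ta a)).
      rewrite [LHS]rowE row_mul; congr (mulmx _ _); apply/rowP => k; rewrite !mxE.
      by rewrite ir andbT val_eqE eq_sym.
    exact: row_sub.
  rewrite Wpid => /submxP[D eD].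
  have : row i (N a) = D *m pid_mx (r (ha a)).
    by rewrite !row_mul eD mulmxA mulmxK.
  move/rowP/(_ j); rewrite !mxE => ->; rewrite big1 // => l _.
  rewrite !mxE; case: eqP => [->|]; rewrite /= ?mulr0 //.
  by rewrite ltnNge rj mulr0.
have NE a : N a = E (ta a) *m (V a)^T *m invmx (E (ha a)) by [].
(* Entries from the complement to [W] acquire a factor [s]. Those from [W] to the complement would
   acquire [s^-1], but they vanish as [W] is a subrepresentation. *)
clearbody N; pose NP a : 'M[{poly K}]_(alpha (ta a), alpha (ha a)) :=
  \matrix_(i, j) (N a i j *: 'X^((r (ta a) <= i)%N && (j < r (ha a))%N)).
pose P a := (map_mx polyC (invmx (E (ta a))) *m NP a *m map_mx polyC (E (ha a)))^T.
have [s x s0|s a s0|] := one_parameter_weight hK (A := flag_torus W)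
  (b := fun x => (r x)%:Z) (P := P) sf fV.
- rewrite det_tr !det_mulmx mulrC mulrA -det_mulmx mulmxV // det1 mul1r det_diag.
  under eq_bigr => i _ do rewrite mxE.
  rewrite -big_mkcond /= -(big_ord_widen _ (fun=> s) (rank_leq_row (W x))).
  by rewrite prodr_const card_ord.
- pose D x : 'M[K]_(alpha x) := diag_mx (\row_i if (i < r x)%N then s else 1).
  have uD x : D x \in unitmx.
    rewrite unitmxE det_diag unitfE; apply/prodf_neq0 => i _; rewrite mxE.
    by case: ifP; rewrite ?oner_eq0.
  have ED x : invmx (flag_torus W s x) = (invmx (E x) *m invmx (D x) *m E x)^T.
    rewrite -trmx_inv /flag_torus !invmxM ?unitmx_mul ?unitmx_inv ?Eu ?uD //.
    by rewrite invmxK mulmxA.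
  have mapC m n (M : 'M[K]_(m, n)) : map_mx (fun p => p.[s]) (map_mx polyC M) = M.
    by apply/matrixP => i j; rewrite !mxE hornerC.
  have mapM m n q (M : 'M_(m, n)) (M' : 'M_(n, q)) : map_mx (fun p => p.[s]) (M *m M') =
      map_mx (fun p => p.[s]) M *m map_mx (fun p => p.[s]) M'.
    exact: (map_mxM (horner_eval s)).
  have ND : N a *m D (ha a) = D (ta a) *m map_mx (fun p => p.[s]) (NP a).
    rewrite mul_mx_diag mul_diag_mx; apply/matrixP => i j.
    rewrite !mxE !hornerE; case: (ltnP i) => ir; case: ltnP => rj /=.
    + by rewrite expr0 mulr1 mulrC.
    + by rewrite N0 // !(mul0r, mulr0).
    + by rewrite expr1 mul1r.
    + by rewrite expr0 mul1r.
  have -> : map_mx (fun p => p.[s]) (P a) =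
      (invmx (E (ta a)) *m map_mx (fun p => p.[s]) (NP a) *m E (ha a))^T.
    by rewrite /P -map_trmx !mapM !mapC.
  rewrite /act ED /flag_torus -/(D _) -[V a]trmxK -!trmx_mul; congr (_^T).
  rewrite -/(E _) -[map_mx _ _](mulKmx (uD (ta a))) -ND NE !mulmxA.
  by [].
move=> h _; apply: le_trans h; rewrite le_eqVlt; apply/orP; left.
by apply/eqP/eq_bigr => x _; rewrite ffunE.
Qed.

Lemma weight_wdot_eq0 : wdot sigma alpha = 0.
Proof.
apply/eqP; rewrite eq_le weight_wdot_ge0 andbT -{1}(dims_full K alpha).
exact: weight_wdot_subrep (subrep_full V).
Qed.

(** Scaling the vertex [x] by [s ^+ height x] multiplies every arrow by a positive power of [s], so
    the limit at [s = 0] is the zero representation. *)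
Lemma weight0_eval0 (hQ : no_oriented_cycles Q) :
  sigma = 0 -> peval f (fun a => 0) = peval f V.
Proof.
move=> sigma0.
have [s x s0|s a s0|_] := one_parameter_weight hK (A := fun s x => (s ^+ height x)%:M)
  (b := fun x => (height x)%:Z * (alpha x)%:Z)
  (P := fun a => 'X^(height (ha a) - height (ta a)) *: map_mx polyC (V a)) sf fV.
- by rewrite det_scalar -exprM.
- rewrite /act invmx_scalar mul_scalar_mx mul_mx_scalar scalerA.
  apply/matrixP => i j; rewrite !mxE !hornerE; congr (_ * _).
  by rewrite expfB ?height_lt // mulrC.
rewrite sigma0 => <-; last by rewrite big1 // => x _; rewrite ffunE mul0r.
apply: peval_ext => a; apply/matrixP => i j; rewrite !mxE !hornerE.
by rewrite expr0n subn_eq0 leqNgt height_lt // mul0r.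
Qed.
End OneParameter.

(** * Decomposition of semi-invariants into weights *)

Section TorusDecomposition.
Variables (K : fieldType) (hK : infinite_field K).
Variables (Q : quiver) (alpha : dimvec Q) (halpha : sincere alpha).
Implicit Types (V : Rep K alpha) (f : polyRep K alpha) (t : vertex Q -> K).

(** A section of the determinant map, so [GL] is generated by [SL] and this torus; sincerity
    supplies the first coordinate at each vertex. *)
Definition diag_torus t : matfam K alpha :=
  fun x => diag_mx (\row_(i < alpha x) if i == 0%N :> nat then t x else 1).

Lemma det_diag_torus t x : \det (diag_torus t x) = t x.
Proof.
rewrite det_diag (bigD1 (Ordinal (halpha x))) //= mxE eqxx big1 ?mulr1 // => i.
by rewrite -val_eqE /= => /negPf h; rewrite mxE h.
Qed.

Lemma diag_torus_GL t : (forall x, t x != 0) -> in_GL (diag_torus t).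
Proof. by move=> t0 x; rewrite unitmxE det_diag_torus unitfE. Qed.

(** The torus character of a coordinate function; the inverse in the action gives the tail the
    positive sign. *)
Definition entry_weight (i : 'I_#|entry alpha|) (x : vertex Q) : int :=
  let c := enum_val i in
  ((x == ta (tag c)) && ((tagged c).2 == 0%N :> nat))%:R -
  ((x == ha (tag c)) && ((tagged c).1 == 0%N :> nat))%:R.

Lemma rep_coord_torus t V i : (forall x, t x != 0) ->
  rep_coord (act (matfam_inv (diag_torus t)) V) i =
  (\prod_x t x ^ entry_weight i x) * rep_coord V i.
Proof.
move=> t0; rewrite /rep_coord /entry_weight; case: (enum_val i) => a [j k] /=.
pose e x (b : bool) := if b then t x else 1.
have e0 x b : e x b != 0 by rewrite /e; case: b; rewrite ?oner_eq0.
have inv_diag x : invmx (diag_torus t x) =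
    diag_mx (\row_(i < alpha x) (e x (i == 0%N :> nat))^-1).
  set M := diag_mx _; have MD : M *m diag_torus t x = 1%:M.
    rewrite mulmx_diag -[RHS]diag_const_mx; congr diag_mx.
    by apply/rowP => l; rewrite !mxE mulVf.
  by rewrite -[LHS]mul1mx -MD mulmxK // diag_torus_GL.
rewrite /act /matfam_inv invmxK inv_diag mul_diag_mx mul_mx_diag !mxE.
rewrite -/(e (ta a) _).
have prod_e x (b : bool) : \prod_y t y ^ (((y == x) && b)%:R : int) = e x b.
  rewrite (bigD1 x) //= eqxx big1 => [|y /negPf ->]; last by rewrite expr0z.
  by rewrite mulr1 /e; case: b.
under eq_bigr => x _ do rewrite expfzDr ?t0 // -invr_expz.
rewrite big_split /= prodfV !prod_e.
by rewrite mulrAC; congr (_ * _); rewrite mulrC.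
Qed.

Definition monom_weight (m : 'X_{1..#|entry alpha|}) : weight Q :=
  [ffun x => \sum_i entry_weight i x * (m i)%:Z].

Definition torus_part (w : weight Q) f : polyRep K alpha :=
  \sum_(m <- msupp f | monom_weight m == w) f@_m *: 'X_[m].

Lemma peval_torus_part w f V :
  peval (torus_part w f) V =
  \sum_(m <- msupp f | monom_weight m == w) f@_m * \prod_i rep_coord V i ^+ m i.
Proof.
rewrite /peval /torus_part raddf_sum /=; apply: eq_bigr => m _.
by rewrite mevalZ mevalX.
Qed.

Lemma torus_part_act w f t V : (forall x, t x != 0) ->
  peval (torus_part w f) (act (matfam_inv (diag_torus t)) V) =
  (\prod_x t x ^ w x) * peval (torus_part w f) V.
Proof.
move=> t0; rewrite !peval_torus_part mulr_sumr; apply: eq_bigr => m /eqP <-.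
rewrite mulrCA; congr (_ * _).
under eq_bigr => i _ do rewrite rep_coord_torus // exprMn.
rewrite big_split /=; congr (_ * _).
under eq_bigr => i _ do rewrite -prodrXl.
rewrite exchange_big; apply: eq_bigr => x _ /=; rewrite ffunE.
rewrite (big_morph (fun z => t x ^ z) (fun a b => expfzDr a b (t0 x)) (expr0z _)).
by apply: eq_bigr => i _; rewrite exprnP exprz_exp.
Qed.

Definition torus_weights f : seq (weight Q) := undup (map monom_weight (msupp f)).

Lemma sum_torus_part f V :
  peval f V = \sum_(w <- torus_weights f) peval (torus_part w f) V.
Proof.
under eq_bigr => w _ do rewrite peval_torus_part.
rewrite /peval mevalE (exchange_big_dep predT) //= big_seq [RHS]big_seq.
apply: eq_bigr => m ms.
rewrite (eq_bigl (fun w => w == monom_weight m)) => [|w]; last exact: eq_sym.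
rewrite -[RHS]big_filter (_ : [seq w <- _ | _] = [:: monom_weight m]) ?big_seq1 //.
by apply: filter_pred1_uniq; rewrite ?undup_uniq // mem_undup map_f.
Qed.

(** The torus normalises [SL], so Dedekind independence passes [SL]-invariance from [f] to each
    torus part. An element of [GL] is then split into an element of [SL] and a torus element with
    the same determinants. *)
Lemma torus_part_SI_weight w f : SI f -> w \in torus_weights f ->
  SI_weight w (torus_part w f).
Proof.
move=> sf wf.
have SLinv B V : in_SL B ->
    peval (torus_part w f) (act (matfam_inv B) V) = peval (torus_part w f) V.
  move=> sB; apply/eqP; rewrite -subr_eq0; apply/eqP.
  pose c w := peval (torus_part w f) (act (matfam_inv B) V) - peval (torus_part w f) V.
  apply: (char_indep hK (c := c) (undup_uniq _) _ wf) => t t0.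
  have tu := diag_torus_GL t0; have Bu := in_SL_GL sB.
  under eq_bigr => v _ do rewrite mulrBl mulrC -torus_part_act //
    [X in _ - X]mulrC -torus_part_act //.
  rewrite sumrB -!sum_torus_part; apply/eqP; rewrite subr_eq0; apply/eqP.
  pose C x := invmx (diag_torus t x) *m B x *m diag_torus t x.
  have sC : in_SL C.
    move=> x; rewrite !det_mulmx mulrAC -det_mulmx mulVmx // det1 mul1r.
    exact: sB.
  rewrite -[RHS](sf C sC); apply: peval_ext => a.
  rewrite !act_comp; try exact: in_GL_inv; try exact: (in_GL_inv (in_SL_GL sC)).
  congr (_ *m _ *m invmx _); rewrite /matfam_inv /C.
    by rewrite !invmxM ?unitmx_mul ?unitmx_inv ?tu ?Bu // invmxK !mulmxA mulmxK.
  by rewrite !invmxM ?unitmx_mul ?unitmx_inv ?tu ?Bu // invmxK !mulmxA mulmxK.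
move=> A uA V; pose t x := \det (A x).
have t0 x : t x != 0 by rewrite -unitfE -unitmxE.
have tu := diag_torus_GL t0.
pose B x := A x *m invmx (diag_torus t x).
have sB : in_SL B.
  by move=> x; rewrite det_mulmx det_inv det_diag_torus mulfV // t0.
transitivity (chi w A * peval (torus_part w f) (act (matfam_inv B) V)); last first.
  by rewrite SLinv.
rewrite /chi -(torus_part_act _ _ _ t0).
apply: peval_ext => a; rewrite act_comp; try exact: in_GL_inv.
  have eB x : matfam_inv (diag_torus t) x *m matfam_inv B x = matfam_inv A x.
    by rewrite /matfam_inv invmxM ?unitmx_inv ?tu // invmxK mulmxA mulVmx ?mul1mx.
  by rewrite /act !eB.
exact: (in_GL_inv (in_SL_GL sB)).
Qed.

End TorusDecomposition.

(** * Determinantal semi-invariants *)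

Lemma det_tens1mx (R : comNzRingType) d N (A : 'M[R]_N) :
  \det (tensmx (1%:M : 'M_d) A) = \det A ^+ d.
Proof.
elim: d => [|d IH]; first by rewrite det_mx00.
have -> : tensmx (1%:M : 'M_d.+1) A =
    block_mx A 0 0 (tensmx (1%:M : 'M_d) A) :> 'M_(N + d * N).
  have idx0 (k : 'I_N) : lshift (d * N) k = mxtens_index (0 : 'I_d.+1, k) :> 'I_(N + d * N).
    exact: val_inj.
  have idxS (i : 'I_d) (k : 'I_N) :
      rshift N (mxtens_index (i, k)) = mxtens_index (lift 0 i : 'I_d.+1, k) :> 'I_(N + d * N).
    by apply: val_inj; rewrite /= /bump leq0n /= mulnDl mul1n addnA.
  have ind (P : 'I_(N + d * N) -> Prop) : (forall k, P (lshift _ k)) ->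
      (forall i k, P (rshift N (mxtens_index (i, k)))) -> forall x, P x.
    move=> Pl Pr x; rewrite -[x]splitK; case: (split x) => [k|y] /=; first exact: Pl.
    by rewrite -[y]mxtens_unindexK; case: (mxtens_unindex y) => i k; apply: Pr.
  have tE (i j : 'I_d.+1) (k l : 'I_N) : (tensmx (1%:M : 'M_d.+1) A : 'M_(N + d * N))
      (mxtens_index (i, k)) (mxtens_index (j, l)) = (1%:M : 'M_d.+1) i j * A k l.
    exact: tensmxE.
  apply/matrixP; elim/ind => [k|i k]; elim/ind => [k'|i' k'].
  - by rewrite block_mxEul !idx0 tE mxE eqxx mul1r.
  - by rewrite block_mxEur idx0 idxS tE !mxE mul0r.
  - by rewrite block_mxEdl idx0 idxS tE !mxE mul0r.
  - by rewrite block_mxEdr !idxS tE tensmxE !mxE (inj_eq lift_inj).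
by rewrite (@det_ublock _ N (d * N)) IH exprS.
Qed.

Lemma det_castmx (R : comNzRingType) m n (e : m = n) (A : 'M[R]_m) :
  \det (castmx (e, e) A) = \det A.
Proof. by case: _ / e. Qed.

Lemma det_mxdiag (R : comNzRingType) p (q : 'I_p -> nat) (B : forall i, 'M[R]_(q i)) :
  \det (\mxdiag_i B i) = \prod_i \det (B i).
Proof.
elim: p q B => [|p IH] q B.
  rewrite [RHS]big_ord0; have d0 n (M : 'M[R]_n) : n = 0%N -> \det M = 1.
    by move=> n0; move: M; rewrite n0 => M; apply: det_mx00.
  by apply: d0; rewrite big_ord0.
rewrite mxdiag_recl det_castmx det_ublock IH big_ord_recl.
by [].
Qed.

Section BlockInjection.
Variables (R : comNzRingType) (p : nat) (q : 'I_p -> nat).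

(** Right multiplication embeds the summand [i] into the direct sum; the transpose is the
    projection. *)
Definition block_inj i : 'M[R]_(q i, \sum_j q j) := submxcol 1%:M i.

Lemma block_inj_mxdiag (B : forall i, 'M[R]_(q i)) i :
  block_inj i *m \mxdiag_j B j = B i *m block_inj i.
Proof.
have : \mxdiag_j B j *m \mxcol_j block_inj j = \mxcol_j (B j *m block_inj j).
  exact: mul_mxdiag_mxcol.
rewrite submxcolK mulmx1 => e.
rewrite -[RHS](mxcolK (fun j => B j *m block_inj j)) -e.
by rewrite /block_inj submxcol_mul mul1mx.
Qed.

Lemma mxdiag_block_inj_tr (B : forall i, 'M[R]_(q i)) i :
  \mxdiag_j B j *m (block_inj i)^T = (block_inj i)^T *m B i.
Proof.
apply: trmx_inj; rewrite !trmx_mul trmxK tr_mxdiag.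
exact: (block_inj_mxdiag (fun j => (B j)^T)).
Qed.

Lemma sum_block_inj : \sum_i (block_inj i)^T *m block_inj i = 1%:M.
Proof.
rewrite -mul_mxrow_mxcol submxcolK -tr_mxcol submxcolK trmx1 mulmx1.
by [].
Qed.

Lemma block_inj_orth i j : i != j -> block_inj i *m (block_inj j)^T = 0.
Proof.
move=> ij; have : \mxblock_(i, j) (block_inj i *m (block_inj j)^T) =
    \mxdiag_i (1%:M : 'M[R]_(q i)).
  by rewrite -mul_mxcol_mxrow submxcolK -tr_mxcol submxcolK trmx1 mulmx1 mxdiagZ.
by rewrite /mxdiag => /eq_mxblockP/(_ i j) ->; rewrite (negPf ij).
Qed.

Lemma block_inj_norm i : block_inj i *m (block_inj i)^T = 1%:M.
Proof.
have : \mxblock_(i, j) (block_inj i *m (block_inj j)^T) =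
    \mxdiag_i (1%:M : 'M[R]_(q i)).
  by rewrite -mul_mxcol_mxrow submxcolK -tr_mxcol submxcolK trmx1 mulmx1 mxdiagZ.
by rewrite /mxdiag => /eq_mxblockP/(_ i i) ->; rewrite eqxx conform_mx_id.
Qed.

End BlockInjection.

Lemma map_block_inj (R S : comNzRingType) (f : {rmorphism R -> S}) p (q : 'I_p -> nat) i :
  map_mx f (block_inj R q i) = block_inj S q i.
Proof.
by apply/matrixP => x y; rewrite !mxE rmorph_nat.
Qed.

Section Walks.
Variables (Q : quiver) (alpha : dimvec Q).

Section Ring.
Variable R : comNzRingType.
Implicit Types M : forall a : arrow Q, 'M[R]_(alpha (ta a), alpha (ha a)).

(** Comparing indices by value avoids a transport along [x = y], so [walk] needs no proof that its
    arrows compose. *)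
Definition vertex_id x y : 'M[R]_(alpha x, alpha y) :=
  \matrix_(i, j) ((x == y) && (i == j :> nat))%:R.

Lemma vertex_id1 x : vertex_id x x = 1%:M.
Proof. by apply/matrixP => i j; rewrite !mxE eqxx. Qed.

Lemma vertex_id0 x y : x != y -> vertex_id x y = 0.
Proof. by move=> /negPf xy; apply/matrixP => i j; rewrite !mxE xy. Qed.

(* The product of the matrices along a walk, or 0 if the arrows [w] do not
   compose to a walk from [x] to [y]. *)
Fixpoint walk M (w : seq (arrow Q)) x y : 'M[R]_(alpha x, alpha y) :=
  if w is a :: w' then vertex_id x (ta a) *m M a *m walk M w' (ha a) y
  else vertex_id x y.

Lemma walk_equivariant M M' (g g' : forall x, 'M[R]_(alpha x)) w x y :
  (forall x, g x *m g' x = 1%:M) ->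
  (forall a, M' a = g (ta a) *m M a *m g' (ha a)) ->
  walk M' w x y = g x *m walk M w x y *m g' y.
Proof.
move=> gg' eM; have gg'' x' : g' x' *m g x' = 1%:M by apply: mulmx1C.
have gid x' y' : g x' *m vertex_id x' y' = vertex_id x' y' *m g y'.
  have [<-|xy] := eqVneq x' y'; first by rewrite vertex_id1 mulmx1 mul1mx.
  by rewrite vertex_id0 // mulmx0 mul0mx.
elim: w x => [|a w IH] x /=; first by rewrite gid -mulmxA gg' mulmx1.
rewrite eM IH !mulmxA gid -!mulmxA; congr (_ *m (_ *m (_ *m _))).
by rewrite mulmxA gg'' mul1mx.
Qed.

Lemma walk_rcons M w a x : walk M (rcons w a) x (ha a) = walk M w x (ta a) *m M a.
Proof.
elim: w x => [|b w IH] x /=; first by rewrite vertex_id1 mulmx1.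
by rewrite IH !mulmxA.
Qed.

(** Each arrow of a nonzero walk raises the height, so finitely many walks suffice. *)
Lemma walk_long (hQ : no_oriented_cycles Q) M w x y :
  (height y < height x + size w)%N -> walk M w x y = 0.
Proof.
elim: w x => [|a w IH] x /=; rewrite ?addn0 => h.
  by rewrite vertex_id0 //; apply: contraTneq h => ->; rewrite ltnn.
have [xa|xa] := eqVneq x (ta a); last by rewrite vertex_id0 // !mul0mx.
rewrite IH ?mulmx0 // (leq_trans h) // addnS -addSn leq_add2r xa.
exact: height_lt.
Qed.

End Ring.

Lemma map_walk (R S : comNzRingType) (f : {rmorphism R -> S})
    (M : forall a : arrow Q, 'M[R]_(alpha (ta a), alpha (ha a))) w x y :
  map_mx f (walk M w x y) = walk (fun a => map_mx f (M a)) w x y.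
Proof.
have id_map x' y' : map_mx f (vertex_id R x' y') = vertex_id S x' y'.
  by apply/matrixP => i j; rewrite !mxE rmorph_nat.
by elim: w x => [|a w IH] x //=; rewrite !map_mxM IH id_map.
Qed.

End Walks.

Lemma castmx_mul3 (R : pzRingType) N N' (e : N' = N) (A : 'M[R]_N) (B : 'M[R]_(N, N'))
    (C : 'M[R]_N') :
  castmx (erefl N, e) (A *m B *m C) = A *m castmx (erefl N, e) B *m castmx (e, e) C.
Proof. by case: _ / e in A B *; rewrite !castmx_id. Qed.

Lemma rank_sum_castmx (F : fieldType) (L : finType) k N N' (e : N' = N)
    (U : 'M[F]_(k, N)) (B : L -> 'M[F]_(N, N')) :
  \rank (\sum_l <<U *m castmx (erefl N, e) (B l)>>)%MS =
  \rank (\sum_l <<U *m B l>>)%MS.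
Proof.
by case: _ / e in U B *; under eq_bigr => l _ do rewrite castmx_id.
Qed.

Section DeterminantalSemiInvariants.
Variables (Q : quiver) (alpha : dimvec Q).
Variables (p p' : nat) (s : 'I_p -> vertex Q) (t : 'I_p' -> vertex Q).
Local Notation sizes := (fun i => alpha (s i)).
Local Notation sizet := (fun j => alpha (t j)).
Local Notation N := (\sum_i sizes i)%N.
Hypothesis eqN : (\sum_j sizet j)%N = N.
Local Notation L := (#|vertex Q|.-bseq (arrow Q) * 'I_p * 'I_p')%type.

(* The coefficients of the generic matrix from the sum of the [V (s i)] to the sum
   of the [V (t j)] whose blocks are linear combinations of walks. *)
Definition walk_mx (R : comNzRingType)
    (M : forall a : arrow Q, 'M[R]_(alpha (ta a), alpha (ha a))) (l : L) : 'M[R]_N :=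
  castmx (erefl N, eqN)
    ((block_inj R sizes l.1.2)^T *m walk M l.1.1 (s l.1.2) (t l.2) *m block_inj R sizet l.2).

Lemma map_walk_mx (R S : comNzRingType) (f : {rmorphism R -> S})
    (M : forall a : arrow Q, 'M[R]_(alpha (ta a), alpha (ha a))) l :
  map_mx f (walk_mx M l) = walk_mx (fun a => map_mx f (M a)) l.
Proof.
by rewrite /walk_mx map_castmx !map_mxM map_walk -map_trmx !map_block_inj.
Qed.

Lemma walk_mx_equivariant (R : comNzRingType)
    (M M' : forall a : arrow Q, 'M[R]_(alpha (ta a), alpha (ha a)))
    (g g' : forall x, 'M[R]_(alpha x)) l :
  (forall x, g x *m g' x = 1%:M) ->
  (forall a, M' a = g (ta a) *m M a *m g' (ha a)) ->
  walk_mx M' l = \mxdiag_i g (s i) *m walk_mx M l *m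
    castmx (eqN, eqN) (\mxdiag_j g' (t j)).
Proof.
move=> gg' eM; rewrite /walk_mx (walk_equivariant _ _ _ gg' eM) -castmx_mul3.
congr castmx; rewrite !mulmxA mxdiag_block_inj_tr -!mulmxA; congr (_ *m (_ *m (_ *m _))).
exact/esym/block_inj_mxdiag.
Qed.

Variables (K : fieldType) (d : nat) (T : L -> 'M[K]_d).

(** The indices are swapped since walks multiply the transposes of the [V a]. *)
Definition generic_arrow (a : arrow Q) : 'M[polyRep K alpha]_(alpha (ta a), alpha (ha a)) :=
  \matrix_(i, j) 'X_(enum_rank
    (Tagged (fun a => ('I_(alpha (ha a)) * 'I_(alpha (ta a)))%type) (j, i))).

Definition det_semi_invariant : polyRep K alpha :=
  \det (blowup (fun l => map_mx (@mpolyC _ K) (T l)) (walk_mx generic_arrow)).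

Lemma peval_det_semi_invariant (V : Rep K alpha) :
  peval det_semi_invariant V = \det (blowup T (walk_mx (fun a => (V a)^T))).
Proof.
rewrite /peval /det_semi_invariant -det_map_mx map_blowup.
congr (\det _); apply: eq_bigr => l _; congr tensmx.
  by apply/matrixP => i j; rewrite !mxE; apply: mevalC.
rewrite map_walk_mx /walk_mx; congr castmx; congr (_ *m _ *m _).
have ext (M M' : forall a : arrow Q, 'M[K]_(alpha (ta a), alpha (ha a))) w x y :
    (forall a, M a = M' a) -> walk M w x y = walk M' w x y.
  by move=> e; elim: w x => //= a w IH x; rewrite e IH.
apply: ext => a; apply/matrixP => i j; rewrite !mxE; apply: etrans (mevalXU _ _) _.
by rewrite /rep_coord enum_rankK.
Qed.

(** Every walk matrix changes by the same outer block diagonal factors; pulled out of the blow-up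
    they become tensors with an identity of size [d], whose determinants are [d]-th powers. *)
Lemma det_semi_invariant_act (A : matfam K alpha) (V : Rep K alpha) : in_GL A ->
  pact A det_semi_invariant V =
  (\prod_i \det (A (s i)) ^+ d) * (\prod_j (\det (A (t j)))^-1 ^+ d) *
  peval det_semi_invariant V.
Proof.
move=> uA; rewrite /pact !peval_det_semi_invariant.
pose g x := (A x)^T; pose g' x := invmx (A x)^T.
have gg' x : g x *m g' x = 1%:M by rewrite mulmxV // unitmx_tr.
have eM a : (act (matfam_inv A) V a)^T = g (ta a) *m (V a)^T *m g' (ha a).
  by rewrite /act /matfam_inv invmxK !trmx_mul trmx_inv mulmxA.
have -> : blowup T (walk_mx (fun a => (act (matfam_inv A) V a)^T)) =
    tensmx 1%:M (\mxdiag_i g (s i)) *m blowup T (walk_mx (fun a => (V a)^T)) *m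
    tensmx 1%:M (castmx (eqN, eqN) (\mxdiag_j g' (t j))).
  rewrite mulmx_sumr mulmx_suml; apply: eq_bigr => l _.
  by rewrite !tensmx_mul mul1mx mulmx1 -(walk_mx_equivariant l gg' eM).
rewrite !det_mulmx !det_tens1mx det_castmx !det_mxdiag -!prodrXl mulrAC.
congr (_ * _ * _); apply: eq_bigr => i _; first by rewrite det_tr.
by rewrite det_inv det_tr.
Qed.

End DeterminantalSemiInvariants.

(** * From semistability to a nonvanishing determinant *)

Section NoShrunkSubspace.
Variables (K : fieldType) (Q : quiver) (hQ : no_oriented_cycles Q) (alpha : dimvec Q).
Variables (p p' : nat) (s : 'I_p -> vertex Q) (t : 'I_p' -> vertex Q).
Local Notation sizes := (fun i => alpha (s i)).
Local Notation sizet := (fun j => alpha (t j)).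
Local Notation N := (\sum_i sizes i)%N.
Hypothesis eqN : (\sum_j sizet j)%N = N.
Variable V : Rep K alpha.
Hypothesis rank_le : forall W, subrep V W ->
  (\sum_i \rank (W (s i)) <= \sum_j \rank (W (t j)))%N.
Local Notation n := #|vertex Q|.
Local Notation M := (fun a => (V a)^T).

(** The block components of [U] generate a subrepresentation [S] under walks. Its sum over the [s i]
    bounds the rank of [U], and its sum over the [t j] is covered by the images of [U]. *)
Lemma walk_mx_rank (U : 'M[K]_N) :
  (\rank U <= \rank (\sum_l <<U *m walk_mx eqN M l>>)%MS)%N.
Proof.
pose E i := block_inj K sizes i; pose E' j := block_inj K sizet j.
pose Ux x := (\sum_i <<U *m (E i)^T *m vertex_id alpha K (s i) x>>)%MS.
pose S x := (\sum_(w : n.-bseq (arrow Q)) \sum_y <<Ux y *m walk M w y x>>)%MS.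
have subS : subrep V S.
  move=> a; rewrite /S !sumsmxMr_gen; apply/sumsmx_subP => w _.
  rewrite genmxE sumsmxMr_gen; apply/sumsmx_subP => y _.
  rewrite genmxE (eqmxMr _ (genmxE _)) -mulmxA -walk_rcons.
  have [le|gt] := leqP (size (rcons w a)) n.
    apply: (sumsmx_sup (Bseq le)) => //; apply: (sumsmx_sup y) => //.
    by rewrite genmxE.
  rewrite walk_long ?mulmx0 ?sub0mx // (leq_ltn_trans (height_le _)) //.
  exact: leq_trans gt (leq_addl _ _).
have rkU : (\rank U <= \sum_i \rank (S (s i)))%N.
  have : (U <= \sum_i <<U *m (E i)^T *m E i>>)%MS.
    rewrite -{1}[U]mulmx1 -(sum_block_inj K sizes) mulmx_sumr; apply: summx_sub => i _.
    by rewrite mulmxA (sumsmx_sup i) // genmxE.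
  move/mxrankS/leq_trans; apply; apply: leq_trans (mxrank_sum_leqif _).1 _.
  apply: leq_sum => i _; rewrite /= genmxE; apply: leq_trans (mxrankM_maxl _ _) _.
  apply: mxrankS; rewrite /S (sumsmx_sup [bseq]) // (sumsmx_sup (s i)) //= genmxE.
  rewrite vertex_id1 mulmx1 /Ux (sumsmx_sup i) // genmxE vertex_id1 mulmx1.
  exact: submx_refl.
apply: leq_trans rkU (leq_trans (rank_le subS) _).
have -> : (\sum_j \rank (S (t j)) = \sum_j \rank (S (t j) *m E' j))%N.
  apply: eq_bigr => j _; rewrite mxrankMfree //.
  by apply/row_freeP; exists (E' j)^T; apply: block_inj_norm.
rewrite -(rank_sum_blocks (P := fun j => (E' j)^T *m E' j)).
- rewrite /walk_mx rank_sum_castmx.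
  apply/mxrankS/sumsmx_subP => j _; rewrite genmxE /S !sumsmxMr_gen.
  apply/sumsmx_subP => w _; rewrite genmxE sumsmxMr_gen.
  apply/sumsmx_subP => x _; rewrite genmxE (eqmxMr _ (genmxE _)) -mulmxA /Ux sumsmxMr_gen.
  apply/sumsmx_subP => i _; rewrite genmxE (eqmxMr _ (genmxE _)).
  have [<-|ix] := eqVneq (s i) x; last by rewrite vertex_id0 // mulmx0 mul0mx sub0mx.
  apply: (sumsmx_sup (w, i, j)) => //=; rewrite genmxE vertex_id1 mulmx1.
  by rewrite !mulmxA.
- by move=> i j ij; rewrite -mulmxA (mulmxA (E' i)) block_inj_orth // mul0mx mulmx0.
- by move=> i; rewrite -mulmxA (mulmxA (E' i)) block_inj_norm mul1mx.
Qed.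

End NoShrunkSubspace.

Section WeightMultiplicities.
Variables (Q : quiver) (mu : vertex Q -> nat).
Local Notation copies := {x : vertex Q & 'I_(mu x)}.

Definition copy_vertex (i : 'I_#|{: copies}|) : vertex Q := tag (enum_val i).

Lemma big_copies (R : Type) (idx : R) (op : Monoid.com_law idx) (F : vertex Q -> R) :
  \big[op/idx]_i F (copy_vertex i) = \big[op/idx]_x \big[op/idx]_(j < mu x) F x.
Proof.
rewrite (sig_big_dep (fun=> true) (fun _ _ => true) (fun x _ => F x)) /=.
rewrite [RHS](reindex (fun i : 'I_#|{: copies}| => enum_val i)) /=.
  by apply: eq_bigl => i.
exists enum_rank => x _; [exact: enum_valK | exact: enum_rankK].
Qed.

Lemma sum_copies (F : vertex Q -> nat) :
  (\sum_i F (copy_vertex i) = \sum_x mu x * F x)%N.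
Proof.
by rewrite big_copies; apply: eq_bigr => x _; rewrite sum_nat_const card_ord.
Qed.

Lemma prod_copies (R : comPzSemiRingType) (F : vertex Q -> R) :
  \prod_i F (copy_vertex i) = \prod_x F x ^+ mu x.
Proof.
by rewrite big_copies; apply: eq_bigr => x _; rewrite prodr_const card_ord.
Qed.

End WeightMultiplicities.

(** An effective form of King's criterion: the multiple [N] of the weight is the size of the
    coefficients given by [blowup_invertible]. *)
Lemma semistable_nonvanishing (K : fieldType) (hK : infinite_field K) (Q : quiver)
    (hQ : no_oriented_cycles Q) (alpha : dimvec Q) (V : Rep K alpha) (sigma : weight Q) :
  semistable_weight V sigma ->
  exists (N : nat) (f : polyRep K alpha),
    [/\ wsize sigma alpha = N, SI_weight [ffun x => N%:Z * sigma x] f & peval f V != 0].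
Proof.
move=> [sa sW].
pose mp x := `|Num.max (sigma x) 0|%N; pose mn x := `|Num.max (- sigma x) 0|%N.
have mpE x : (mp x)%:Z = Num.max (sigma x) 0 by rewrite /mp gez0_abs // le_max lexx orbT.
have mnE x : (mn x)%:Z = Num.max (- sigma x) 0 by rewrite /mn gez0_abs // le_max lexx orbT.
have sigmaE x : sigma x = (mp x)%:Z - (mn x)%:Z by rewrite mpE mnE; lia.
pose s := @copy_vertex Q mp; pose t := @copy_vertex Q mn.
have sumE (b : dimvec Q) :
    (\sum_i b (s i))%N%:Z - (\sum_j b (t j))%N%:Z = wdot sigma b.
  rewrite !sum_copies /wdot -!natz !natr_sum -sumrB; apply: eq_bigr => x _.
  by rewrite !natz sigmaE !PoszM mulrBl.
have eqN : (\sum_j alpha (t j) = \sum_i alpha (s i))%N.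
  by have := sumE alpha; rewrite sa => /eqP; rewrite subr_eq0 => /eqP [].
set N := (\sum_i alpha (s i))%N.
have rank_le W : subrep V W -> (\sum_i \rank (W (s i)) <= \sum_j \rank (W (t j)))%N.
  move=> /sW; rewrite -sumE subr_le0 lez_nat.
  by under eq_bigr => i _ do rewrite ffunE; under [X in (_ <= X)%N]eq_bigr => j _ do rewrite ffunE.
have [T uT] := blowup_invertible hK (walk_mx_rank hQ eqN rank_le).
exists N, (det_semi_invariant eqN T); split.
- rewrite /wsize /wdot /N sum_copies -natz natr_sum; apply: eq_bigr => x _.
  by rewrite ffunE natz PoszM mpE.
- move=> A uA V'; rewrite det_semi_invariant_act //; congr (_ * _).
  rewrite (prod_copies mp (fun x => \det (A x) ^+ N)).
  rewrite (prod_copies mn (fun x => (\det (A x))^-1 ^+ N)).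
  rewrite -big_split; apply: eq_bigr => x _ /=; rewrite ffunE sigmaE.
  have u0 : \det (A x) != 0 by rewrite -unitfE -unitmxE.
  rewrite mulrBr expfzDr // -!PoszM -invr_expz -!exprnP !exprM.
  by rewrite -exprVn -exprVn.
- by rewrite peval_det_semi_invariant -unitfE -unitmxE.
Qed.

(** * Homogeneous components and comparison with the null cone *)

Section HomogeneousComponents.
Variables (K : fieldType) (hK : infinite_field K) (Q : quiver) (alpha : dimvec Q).
Implicit Types (V : Rep K alpha) (f : polyRep K alpha).

Lemma peval_homog_scale d f V (s : K) : f \is d.-homog ->
  peval f (fun a => s *: V a) = s ^+ d * peval f V.
Proof.
move=> /dhomogP hf; rewrite /peval !mevalE mulr_sumr big_seq [RHS]big_seq.
apply: eq_bigr => m ms; have <- : mdeg m = d by apply: hf.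
rewrite mulrCA; congr (_ * _).
rewrite mdegE -prodrXr -big_split; apply: eq_bigr => i _ /=.
by rewrite -exprMn /rep_coord mxE.
Qed.

Lemma peval_sum_pihomog f V k : (msize f <= k)%N ->
  peval f V = \sum_(d < k) peval (pihomog mdeg d f) V.
Proof.
move=> le_k; rewrite /peval -raddf_sum; congr (meval _ _).
exact: pihomog_partitionE.
Qed.

(** Scaling [V] commutes with the group action, so the equation for [f] separates into the
    coefficients of the powers of [s]. *)
Lemma pihomog_SI_weight sigma f d : SI_weight sigma f ->
  SI_weight sigma (pihomog mdeg d f).
Proof.
move=> sf A uA V; apply/eqP; rewrite -subr_eq0; apply/eqP.
(* The bound [d.+1] keeps the coefficient of degree [d] in range even when [f] has smaller
   degree. *)
pose k := maxn (msize f) d.+1.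
pose c (i : nat) := pact A (pihomog mdeg i f) V - chi sigma A * peval (pihomog mdeg i f) V.
have -> : pact A (pihomog mdeg d f) V - chi sigma A * peval (pihomog mdeg d f) V =
    (\poly_(i < k) c i)`_d.
  by rewrite coef_poly leq_max leqnn orbT.
suff -> : \poly_(i < k) c i = 0 by rewrite coef0.
apply: (poly_eq0_nonzero hK) => s _; rewrite horner_poly.
have le_k : (msize f <= k)%N by rewrite leq_maxl.
have := sf A uA (fun a => s *: V a); rewrite /pact.
rewrite (peval_ext f (V' := fun a => s *: act (matfam_inv A) V a)) => [|a]; last first.
  by rewrite /act -scalemxAr -scalemxAl.
rewrite !(peval_sum_pihomog _ le_k) mulr_sumr => /eqP; rewrite -subr_eq0 -sumrB => /eqP e.
rewrite -[RHS]e.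
apply: eq_bigr => i _; rewrite !(peval_homog_scale _ _ (pihomogP _ _ _)) /c /pact.
by ring.
Qed.

Lemma SI_weight_SI sigma f : SI_weight sigma f -> SI f.
Proof.
move=> sf A sA V; rewrite sf; last exact: in_SL_GL.
by rewrite /chi big1 ?mul1r // => x _; rewrite sA exp1rz.
Qed.

(** Constants are fixed by the group, whereas a nonzero weight is a nontrivial character because
    sincerity makes every determinant take all nonzero values. *)
Lemma SI_weight_const (halpha : sincere alpha) sigma (c : K) :
  sigma != 0 -> SI_weight sigma (c%:MP : polyRep K alpha) -> c = 0.
Proof.
move=> s0 sf; have [x sx] : exists x, sigma x != 0.
  apply/existsP; apply: contraNT s0; rewrite negb_exists => /forallP h.
  by apply/eqP/ffunP => x; rewrite ffunE; apply/eqP; have := h x; rewrite negbK.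
have [u u0] := expz_neq hK sx; rewrite expr0z => ux.
pose t y := if y == x then u else 1.
have t0 y : t y != 0 by rewrite /t; case: ifP; rewrite ?oner_eq0.
have := sf _ (diag_torus_GL halpha t0) (fun=> 0).
rewrite /pact /peval !mevalC /chi (bigD1 x) //= det_diag_torus // /t eqxx.
rewrite big1 ?mulr1 => [|y /negPf yx]; last by rewrite det_diag_torus // yx exp1rz.
move/eqP; rewrite -subr_eq0 -{1}[c]mul1r -mulrBl mulf_eq0 subr_eq0 eq_sym.
by rewrite (negPf ux) => /eqP.
Qed.

Lemma null_cone_vanishing (halpha : sincere alpha) V sigma f :
  null_cone V -> sigma != 0 -> SI_weight sigma f -> peval f V = 0.
Proof.
move=> nV s0 sf; rewrite (peval_sum_pihomog V (leqnn _)) big1 // => d _.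
have sfd := pihomog_SI_weight d sf.
have [[c ec]|nc] := classic (is_const (pihomog mdeg d f)).
  move: sfd; rewrite ec => /(SI_weight_const halpha s0) ->.
  by rewrite /peval mevalC.
apply: nV nc; first exact: SI_weight_SI sfd.
by exists d; apply: pihomogP.
Qed.

Lemma nonvanishing_semistable (hQ : no_oriented_cycles Q) (halpha : sincere alpha) V f :
  SI f -> is_homogeneous f -> ~ is_const f -> peval f V != 0 ->
  exists2 sigma : weight Q, sigma != 0 & semistable_weight V sigma.
Proof.
move=> sf [d hd] nc fV.
have [w wf fwV] : exists2 w, w \in torus_weights f & peval (torus_part w f) V != 0.
  apply: NNPP => h; case/eqP: fV; rewrite sum_torus_part big_seq big1 // => w wf.
  by apply/eqP/negPn/negP => nz; apply: h; exists w.
have sw := torus_part_SI_weight hK halpha sf wf; exists w; last first.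
  split; first exact: (weight_wdot_eq0 hK sw fwV).
  exact: (weight_wdot_subrep hK sw fwV).
(* A part of weight 0 takes at [V] its value at 0, which vanishes because [f] is homogeneous of
   positive degree. *)
apply: contra (fwV) => /eqP w0; rewrite -(weight0_eval0 hK sw fwV hQ w0).
rewrite peval_torus_part big_seq_cond big1 // => m /andP[ms _].
have d0 : d != 0%N.
  apply: contra_notN nc => /eqP d0; exists f@_0%MM; apply/mpolyP => m'.
  rewrite mcoeffC; have [->|m'0] := eqVneq m' 0%MM; first by rewrite mulr1.
  rewrite mulr0; apply: dhomog_nemf_coeff hd _.
  by rewrite d0 mdeg_eq0.
have [i mi] : exists i, m i != 0%N.
  apply/existsP; apply: contraNT d0; rewrite negb_exists => /forallP h.
  have <- : mdeg m = d by apply: dhomog_mf hd _ ms.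
  rewrite mdegE sum_nat_eq0; apply/forallP => i.
  by have := h i; rewrite negbK.
by rewrite (bigD1 i) //= /rep_coord mxE expr0n (negPf mi) mul0r mulr0.
Qed.

End HomogeneousComponents.

Theorem theorem1p2 (K : fieldType) (hK : infinite_field K)
    (Q : quiver) (hQ : no_oriented_cycles Q)
    (n : nat) (hn : n = #|vertex Q|)
    (alpha : dimvec Q) (halpha : sincere alpha)
    (V : Rep K alpha) :
  null_cone V <->
  (forall sigma : weight Q,
     sigma != 0 -> wdot sigma alpha = 0 ->
     ((wsize sigma alpha)%:~R : rat) <=
       (norm1 alpha)%:R ^+ (2 * n) /
       (4%:R * (n%:R - 1) ^+ (2 * n - 2)) ->
     forall f : polyRep K alpha, SI_weight sigma f -> peval f V = 0).
Proof.
split=> [nV sigma s0 _ _ f sf|vanish f sf hf nc].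
  exact: (null_cone_vanishing hK halpha nV s0 sf).
apply/eqP/negPn/negP => fV.
have [sigma0 s00 sst0] := nonvanishing_semistable hK hQ halpha sf hf nc fV.
have [sigma [s0 sst bound]] := bounded_semistable_weight hQ halpha s00 sst0.
have [N [g [eN sg gV]]] := semistable_nonvanishing hK hQ sst.
have [x sx] : exists x, sigma x != 0.
  apply/existsP; apply: contraNT s0; rewrite negb_exists => /forallP h.
  by apply/eqP/ffunP => x; rewrite ffunE; apply/eqP; have := h x; rewrite negbK.
have Npos : (0 < N)%N.
  have : 0 < 2%:R * wsize sigma alpha.
    rewrite wsize_norm ?sst.1 // (bigD1 x) //= ltr_pwDl ?sumr_ge0 //.
    by rewrite mulr_gt0 ?normr_gt0 // ltz_nat halpha.
  by rewrite eN pmulr_rgt0.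
case/negP: gV; apply/eqP; apply: vanish sg.
- apply: contra (sx) => /eqP/ffunP/(_ x); rewrite !ffunE => /eqP.
  by rewrite mulf_eq0 eqz_nat -[N == 0%N]negbK -lt0n Npos.
- have -> : wdot [ffun x => N%:Z * sigma x] alpha = N%:Z * wdot sigma alpha.
    by rewrite mulr_sumr; apply: eq_bigr => y _; rewrite ffunE mulrA.
  by rewrite sst.1 mulr0.
have -> : wsize [ffun x => N%:Z * sigma x] alpha = N%:Z * N%:Z.
  rewrite -[X in _ = _ * X]eN mulr_sumr; apply: eq_bigr => y _.
  by rewrite !ffunE mulrA maxr_pMr // mulr0.
have [k nk] : exists k, n = k.+1.
  by exists n.-1; rewrite prednK // hn; apply/card_gt0P; exists x.
rewrite -hn nk /= eN in bound; rewrite nk.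
have -> : (k.+1%:R - 1 = k%:R :> rat) by rewrite -natr1 addrK.
have -> : (2 * k.+1 - 2 = k * 2)%N by lia.
(* A single vertex gives [k = 0], where the factor is [0 ^+ 0 = 1]. *)
have kpos : 0 < (k%:R : rat) ^+ k.
  by case: k {nk bound} => [|k]; rewrite ?expr0 // exprn_gt0 // ltr0n.
have boundQ : 2%:R * N%:R * (k%:R : rat) ^+ k <= (norm1 alpha)%:R ^+ k.+1.
  by move: bound; rewrite -(ler_int rat) !rmorphM !rmorphXn /= !pmulrn.
(* The goal is the square of [boundQ], since the weight [N sigma] has size [N ^ 2]. *)
rewrite mulnC !exprM ler_pdivlMr; last by rewrite mulr_gt0 // exprn_gt0.
have -> : ((N%:Z * N%:Z)%:~R : rat) * (4%:R * (k%:R ^+ k) ^+ 2) =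
    (2%:R * N%:R * k%:R ^+ k) ^+ 2.
  by rewrite rmorphM /= -!pmulrn; ring.
by rewrite lerXn2r // nnegrE ?mulr_ge0 ?exprn_ge0 ?ler0n // ltW.
Qed.
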